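(* Let $d\ge 1$, let $\{b_{ij}\}_{1\le i,j\le d}$ be a symmetric array of nonnegative reals, and let $X$ be the $d\times d$ symmetric random matrix with entries $X_{ij}=b_{ij}g_{ij}$ described in the context. Let $g_1,\ldots,g_d$ be i.i.d. standard Gaussian random variables. If the $d\times d$ matrix $B$ with entries $B_{ij}=b_{ij}^2$ is positive semidefinite, then $$ \mathbf{E}\|X\|\le 2\,\mathbf{E}\Bigg[\max_i\sqrt{\sum_j b_{ij}^2g_j^2}\Bigg]+2\max_{ij}b_{ij}. $$
   Context: $\{b_{ij}\}_{1\le i,j\le d}$ are nonnegative reals with $b_{ij}=b_{ji}$; $\{g_{ij}: i\ge j\}$ are independent standard Gaussian random variables, and $g_{ij}:=g_{ji}$ for $i<j$. $X$ is the $d\times d$ symmetric random matrix with entries $X_{ij}=b_{ij}g_{ij}$. $\|\cdot\|$ is the spectral norm (operator norm on Euclidean space). All indices range over $\{1,\dots,d\}$. *)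

(* Defs.v *)
From HB Require Import structures.
From mathcomp Require Import all_boot all_order all_algebra finmap.
From mathcomp Require Import all_classical all_reals all_analysis.

Set Implicit Arguments.
Unset Strict Implicit.
Unset Printing Implicit Defensive.

Import Order.TTheory GRing.Theory Num.Theory.
Import numFieldNormedType.Exports.

Local Open Scope classical_set_scope.
Local Open Scope ring_scope.

(* The two laws are compared on measurable sets only: [normal_prob] is defined
   by an integral and has no meaning on other sets. *)
Definition std_gaussian (disp : measure_display) (T : measurableType disp)
    (R : realType) (P : probability T R) (Z : {RV P >-> R}) : Prop :=
  forall A : set R, measurable A -> distribution P Z A = normal_prob 0 1 A.

Definition mutually_independent (disp : measure_display)
    (T : measurableType disp) (R : realType) (P : probability T R)
    (I : choiceType) (D : set I) (Z : I -> {RV P >-> R}) : Prop :=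
  forall (J : {fset I}) (A : I -> set R),
    [set` J] `<=` D -> (forall i, measurable (A i)) ->
    P (\bigcap_(i in [set` J]) (Z i @^-1` A i)) =
    (\prod_(i <- J) P (Z i @^-1` A i))%E.

(* The library norm on matrices is the sup norm of the entries, hence these
   definitions. *)
Definition euclidean_norm (R : realType) (n : nat) (x : 'cV[R]_n) : R :=
  Num.sqrt (\sum_i x i 0 ^+ 2).

Definition spectral_norm (R : realType) (n : nat) (A : 'M[R]_n) : R :=
  sup [set euclidean_norm (A *m x) | x in [set x | euclidean_norm x <= 1]].

Definition positive_semidefinite (R : realType) (n : nat) (A : 'M[R]_n) : Prop :=
  A^T = A /\ forall x : 'cV[R]_n, 0 <= (x^T *m A *m x) 0 0.

(* Only the variables [g i j] with [j <= i] are used; above the diagonal the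
   entry is [b i j * g j i]. *)
Definition gaussian_mx (disp : measure_display) (T : measurableType disp)
    (R : realType) (P : probability T R) (d : nat) (b : 'I_d -> 'I_d -> R)
    (g : 'I_d * 'I_d -> {RV P >-> R}) (w : T) : 'M[R]_d :=
  \matrix_(i, j) (b i j * (if (j <= i)%N then g (i, j) w else g (j, i) w)).

(* Main.v *)
Require Import Defs.
From HB Require Import structures.
From mathcomp Require Import all_boot all_order all_algebra finmap.
From mathcomp Require Import all_classical all_reals all_analysis.
From mathcomp Require Import measurable_realfun.
From mathcomp Require Import ring lra.

Set Implicit Arguments.
Unset Strict Implicit.
Unset Printing Implicit Defensive.

Import Order.TTheory GRing.Theory Num.Theory.
Import numFieldNormedType.Exports.

Local Open Scope classical_set_scope.
Local Open Scope ring_scope.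

(* Let [B] be the matrix of the [b i j ^+ 2].  With
   [a_i(v) = sqrt (sum_j b i j ^+ 2 * v j ^+ 2)], the Gaussian process
   [s <v, X v>] ([|v| <= 1], [s = 1] or [s = -1]) has smaller increments than
   [2 sum_i v_i a_i(v) g_i + sqrt 2 (max b) s g'] with [g'] an extra Gaussian:
   positivity of [B] is used for
   [(v^2 - w^2)' B (v^2 - w^2) >= 0], squares being taken entrywise.  By
   Cauchy-Schwarz the supremum of the second process is at most
   [2 max_i sqrt (sum_j b i j ^+ 2 * g j ^+ 2) + sqrt 2 (max b) |g'|], and
   [E |g'| <= sqrt 2] because [|x| <= exp (x^2 / 4)].

   The suprema are compared by a Sudakov-Fernique inequality on a finite net of
   the ball.  The maximum is replaced by the log-sum-exp function [F], and the
   law of a Gaussian vector with independent components along [a_1, ..., a_n] is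
   encoded by the commuting averaging operators
   [Q_a F(z) = E F(z + g a)]; they satisfy [Q_(a/sqrt N)^N = Q_a].  Since the
   Hessian of [F] in the direction [a] is
   [1/2 sum_(v, w) p_v p_w (a_v - a_w)^2], the comparison of increments gives
   [prod Q_(a/sqrt N) F <= prod Q_(a'/sqrt N) F + O(N^(-3/2))] pointwise, hence
   the inequality after [N] steps; neither Gaussian integration by parts nor
   differentiation under the integral sign is involved. *)

(** * One-dimensional Gaussian integrals *)

(** The sign [s] turns the supremum of a quadratic form into an absolute value, which for a
    symmetric matrix controls the norm. The row process does not see [s]: at [v = w] with opposite
    signs its increment vanishes while that of [s <v, X v>] need not, and the extra Gaussian pays
    for this. Between two opposite signs its squared increment is
    [(2 sqrt 2 max b)^2 = 8 (max b)^2], which is exactly the bound available for the matrix process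
    after a flip; the final [2 max b] is [sqrt 2 * sqrt 2 * max b].

    Averaging operators keep only the laws: the two processes are never coupled, and [g'] is not a
    random variable on the probability space but one more operator, applied innermost.

    Besides [N], two parameters are removed at the end. A net of mesh [e] costs the factor
    [1 - 2 e]; a scaling [t] of the processes costs [ln (card of the net) / t]. The net is fixed
    before [t] is taken large, and [e] tends to 0 last.

    Measurability of the spectral norm is not established: its expectation is handled through
    pointwise inequalities and an integral that is monotone on arbitrary functions. *)

Section gaussian_line.
Context {R : realType}.
Local Notation mu := (@lebesgue_measure R).
Local Notation gamma := (@normal_prob R 0 1).

Import HBNNSimple.

(** On indicators this is the definition of [normal_prob]; simple functions follow by linearity, and
    monotone convergence is used on both sides. *)
Lemma integral_normal_probE (m s : R) (f : _ -> \bar R) :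
  measurable_fun setT f -> (forall x, 0 <= f x)%E ->
  (\int[normal_prob m s]_x f x =
   \int[mu]_x (f x * (normal_pdf m s x)%:E))%E.
Proof.
move=> mf f0.
have mpdf : measurable_fun setT (fun x : R => (normal_pdf m s x)%:E).
  by apply/measurable_EFinP; exact: measurable_normal_pdf.
have pdf0 x : (0 <= (normal_pdf m s x)%:E)%E by rewrite lee_fin normal_pdf_ge0.
pose f_ := nnsfun_approx measurableT mf.
have cvf x : EFin \o f_^~ x @ \oo --> f x.
  by apply: cvg_nnsfun_approx.
transitivity (limn (fun n => \int[normal_prob m s]_x (f_ n x)%:E))%E.
  rewrite -monotone_convergence//=.
  - by apply: eq_integral => x _; apply/esym/cvg_lim => //; exact: cvf.
  - by move=> n; exact/measurable_EFinP/measurable_funTS.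
  - by move=> n x _; rewrite lee_fin.
  - by move=> x _ a b ab; rewrite lee_fin; exact/lefP/nd_nnsfun_approx.
transitivity (limn (fun n =>
    \int[mu]_x ((f_ n x)%:E * (normal_pdf m s x)%:E)))%E; last first.
  rewrite -monotone_convergence//=.
  - apply: eq_integral => x _; apply/cvg_lim => //.
    by apply: cvgeZr => //; exact: cvf.
  - move=> n; apply: emeasurable_funM => //.
    exact/measurable_EFinP/measurable_funTS.
  - by move=> n x _; rewrite mule_ge0// lee_fin.
  - move=> x _ a b ab; apply: lee_wpmul2r => //.
    by rewrite lee_fin; exact/lefP/nd_nnsfun_approx.
congr (limn _); apply/funext => n.
under [LHS]eq_integral do rewrite fimfunE -fsumEFin//.
rewrite [LHS]ge0_integral_fsum//; last 2 first.
  - by move=> r; exact/measurable_EFinP/measurableT_comp.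
  - by move=> r x _; rewrite EFinM nnfun_muleindic_ge0.
under [RHS]eq_integral.
  move=> x xD; rewrite fimfunE -fsumEFin// muleC ge0_mule_fsumr; last first.
    by move=> r; rewrite EFinM nnfun_muleindic_ge0.
  over.
rewrite [RHS]ge0_integral_fsum//; last 2 first.
  - move=> r; apply: emeasurable_funM => //.
    by apply/measurable_EFinP; do 2 apply/measurableT_comp => //.
  - by move=> r x _; rewrite EFinM mule_ge0// nnfun_muleindic_ge0.
apply: eq_fsbigr => r _.
rewrite integralZl_indic_nnsfun//= integral_indic//= setIT.
have [r0|r0] := ltP r 0.
  rewrite preimage_nnfun0// measure0 mule0.
  under eq_integral do rewrite indicE in_set0 mulr0 mule0.
  by rewrite integral0.
rewrite /normal_prob integral_mkcond -ge0_integralZl//=.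
- apply: eq_integral => x _; rewrite patchE indicE.
  by case: ifPn => _; rewrite ?mulr1 ?mulr0 ?mule0// muleC.
- exact/(measurable_restrictT _ _).1/measurable_funTS.
- by move=> x _; rewrite patchE; case: ifPn.
Qed.

(** The image of Lebesgue measure under [x |-> a + b * x], multiplied by [b], gives half-open
    intervals their length, so it is Lebesgue measure by uniqueness. *)
Lemma ge0_integral_affine (a b : R) (f : _ -> \bar R) : 0 < b ->
  measurable_fun setT f -> (forall x, 0 <= f x)%E ->
  (\int[mu]_x f x = b%:E * \int[mu]_x f (a + b * x)%R)%E.
Proof.
move=> b0 mf f0.
pose phi : measurableTypeR R -> measurableTypeR R := fun x : R => a + b * x.
have mphi : measurable_fun setT phi.
  by apply: measurable_funD => //; exact: measurable_funM.
have b0' : 0 <= b by exact: ltW.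
pose M := mscale (NngNum b0')
  (measure_function_pushforward__canonical__measure_function_Measure mu mphi).
have muM A : measurable A -> mu A = M A.
  move=> mA; apply: (lebesgue_measure_unique _ mA) => _ [[l r]] _ <-.
  rewrite /M/= /mscale/= /pushforward.
  rewrite (_ : phi @^-1` _ = `](l - a) / b, (r - a) / b]%classic); last first.
    apply/seteqP; split => x /=; rewrite !in_itv/= /phi => /andP[h1 h2].
      by rewrite ltr_pdivrMr// ler_pdivlMr//; apply/andP; split; lra.
    move: h1 h2; rewrite ltr_pdivrMr// ler_pdivlMr// => h1 h2.
    by apply/andP; split; lra.
  rewrite !lebesgue_measure_itv/= !lte_fin ltr_pM2r ?invr_gt0// ltrD2r.
  case: ifPn => _; last by rewrite mule0.
  rewrite -!EFinB -EFinM; congr (_%:E).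
  by field; rewrite gt_eqF.
transitivity (\int[M]_x f x)%E.
  by apply: eq_measure_integral => A mA _; exact: muM.
rewrite ge0_integral_mscale//= ge0_integral_pushforward//.
Qed.
End gaussian_line.

Section gaussian_stability.
Context {R : realType}.
Local Notation mu := (@lebesgue_measure R).
Local Notation gamma := (@normal_prob R 0 1).
Local Notation gR := (measurableTypeR R).

Lemma normal_pdf01E (x : R) :
  normal_pdf 0 1 x = normal_peak 1 * expR (- x ^+ 2 / 2).
Proof.
rewrite normal_pdfE ?oner_eq0// /normal_fun subr0.
by rewrite expr1n -[1 *+ 2]/2%:R.
Qed.

Lemma normal_peakM (b : R) : 0 < b -> b * normal_peak b = normal_peak 1.
Proof.
move=> b0; rewrite /normal_peak -mulrnAr sqrtrM ?sqr_ge0// sqrtr_sqr gtr0_norm//.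
rewrite -[in RHS]mulrnAr expr1n mul1r invfM mulrA divff ?mul1r// gt_eqF//.
Qed.

Lemma normal_pdf_affine (m b x : R) : 0 < b ->
  b * normal_pdf m b (m + b * x) = normal_pdf 0 1 x.
Proof.
move=> b0; have bn0 : b != 0 by rewrite gt_eqF.
rewrite normal_pdf01E normal_pdfE// mulrA normal_peakM// /normal_fun.
by congr (_ * expR _); rewrite -mulr_natr; field.
Qed.

(** Both products are the same multiple of [exp (- (y^2 - 2 a s y + s^2) / (2 b^2))], symmetric in
    [s] and [y]: for independent standard [s] and [t], the variables [s] and [a s + b t] are
    exchangeable. *)
Lemma normal_pdf_swap (a b s y : R) : 0 < b -> a ^+ 2 + b ^+ 2 = 1 ->
  normal_pdf (a * s) b y * normal_pdf 0 1 s =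
  normal_pdf (a * y) b s * normal_pdf 0 1 y.
Proof.
move=> b0 ab; have bn0 : b != 0 by rewrite gt_eqF.
rewrite !normal_pdf01E !normal_pdfE// /normal_fun.
rewrite ![_ * expR _ * (_ * expR _)]mulrACA -!expRD; congr (_ * expR _).
rewrite -[b ^+ 2 *+ 2]mulr_natr.
have -> : - (y - a * s) ^+ 2 / (b ^+ 2 * 2) + - s ^+ 2 / 2 =
  - ((y - a * s) ^+ 2 + b ^+ 2 * s ^+ 2) / (b ^+ 2 * 2) by field.
have -> : - (s - a * y) ^+ 2 / (b ^+ 2 * 2) + - y ^+ 2 / 2 =
  - ((s - a * y) ^+ 2 + b ^+ 2 * y ^+ 2) / (b ^+ 2 * 2) by field.
have -> : b ^+ 2 = 1 - a ^+ 2 by rewrite -ab addrC addKr.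
by congr (- _ / _); ring.
Qed.

Lemma measurable_normal_pdf2 (a b : R) : b != 0 ->
  measurable_fun [set: gR * gR]
    (fun z : gR * gR => normal_pdf (a * z.1) b z.2).
Proof.
move=> b0.
under eq_fun do rewrite normal_pdfE//.
apply: measurable_funM => //; apply: measurableT_comp => //.
apply: measurable_funM => //; apply: measurableT_comp => //.
apply: measurable_funX; apply: measurable_funB => //.
exact: measurable_funM.
Qed.

(** Rotation invariance of the plane Gaussian, seen on one coordinate: the joint density of [s] and
    [y = a s + b t] is symmetric, so [y] has the law of [s]. *)
Lemma ge0_integral_normal_prob_convolution (a b : R) (f : gR -> \bar R) :
  0 < b -> a ^+ 2 + b ^+ 2 = 1 ->
  measurable_fun setT f -> (forall x, 0 <= f x)%E ->
  (\int[gamma]_s \int[gamma]_t f (a * s + b * t)%R = \int[gamma]_x f x)%E.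
Proof.
move=> b0 ab mf f0; have bn0 : b != 0 by rewrite gt_eqF.
have pdf0 m s (x : R) : (0 <= (normal_pdf m s x)%:E)%E.
  by rewrite lee_fin normal_pdf_ge0.
have mpdf m s : measurable_fun [set: gR] (fun x => (normal_pdf m s x)%:E).
  by apply/measurable_EFinP; exact: measurable_normal_pdf.
have maff s : measurable_fun [set: gR] (fun t : gR => f (a * s + b * t)%R).
  by apply: measurableT_comp => //; exact: measurable_funD.
have inner s : (\int[gamma]_t f (a * s + b * t)%R =
    \int[mu]_y (f y * (normal_pdf (a * s) b y)%:E))%E.
  rewrite (integral_normal_probE 0 1 (maff s) (fun t => f0 _)).
  rewrite (@ge0_integral_affine _ (a * s) b (fun y => f y * _)%E)//.
  - rewrite -ge0_integralZl//.
    + apply: eq_integral => t _.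
      by rewrite muleCA -EFinM normal_pdf_affine.
    + apply: emeasurable_funM => //.
      apply: (measurableT_comp (mpdf (a * s) b)).
      by apply: measurable_funD => //; exact: measurable_funM.
    + by move=> x _; rewrite mule_ge0.
    + by rewrite lee_fin ltW.
  - by apply: emeasurable_funM.
  - by move=> x; rewrite mule_ge0.
have m2 : measurable_fun [set: gR * gR]
    (fun z : gR * gR => f z.2 * (normal_pdf (a * z.1) b z.2)%:E)%E.
  apply: emeasurable_funM; first exact: measurableT_comp.
  by apply/measurable_EFinP; exact: measurable_normal_pdf2.
under eq_integral do rewrite inner.
rewrite [LHS]integral_normal_probE; last 2 first.
- have pos (z : gR * gR) : (0 <= f z.2 * (normal_pdf (a * z.1) b z.2)%:E)%E.
    by rewrite mule_ge0.
  exact: (measurable_fun_fubini_tonelli_F _ m2 pos).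
- by move=> s; apply: integral_ge0 => y _; rewrite mule_ge0.
rewrite [RHS]integral_normal_probE//.
under eq_integral do rewrite muleC.
transitivity (\int[mu]_s \int[mu]_y ((normal_pdf 0 1 s)%:E *
    (f y * (normal_pdf (a * s) b y)%:E)))%E.
  apply: eq_integral => s _; rewrite ge0_integralZl//.
  - by apply: emeasurable_funM.
  - by move=> y _; rewrite mule_ge0.
have := @fubini_tonelli _ _ _ _ _ mu mu
  (fun z : gR * gR => (normal_pdf 0 1 z.1)%:E *
    (f z.2 * (normal_pdf (a * z.1) b z.2)%:E))%E.
rewrite /fubini_F /fubini_G/= => -> //; last 2 first.
- apply: emeasurable_funM => //.
  by apply: (measurableT_comp (mpdf 0 1)) => //.
- by move=> z; rewrite !mule_ge0.
(* After the swap, [s] carries the Gaussian density of mean [a * y] and deviation [b], whose total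
   mass is 1. *)
apply: eq_integral => y _.
under eq_integral.
  move=> s _; rewrite muleCA -EFinM mulrC normal_pdf_swap// mulrC EFinM muleA.
  over.
rewrite ge0_integralZl//.
- by rewrite integral_normal_pdf mule1.
- by rewrite mule_ge0.
Qed.

(** The weight turns the standard density into [sqrt 2] times the centred Gaussian density of
    variance 2. *)
Lemma integral_expR_sqr4 :
  (\int[gamma]_s (expR (s ^+ 2 / 4))%:E = (Num.sqrt 2)%:E)%E.
Proof.
have s20 : Num.sqrt 2 != 0 :> R by rewrite sqrtr_eq0 -ltNge.
rewrite [LHS]integral_normal_probE; last 2 first.
- apply/measurable_EFinP; apply: measurableT_comp => //.
  by apply: measurable_funM => //; exact: measurable_funX.
- by move=> x; rewrite lee_fin expR_ge0.
transitivity (\int[mu]_x ((Num.sqrt 2)%:E *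
    (normal_pdf 0 (Num.sqrt 2) x)%:E))%E.
  apply: eq_integral => x _; rewrite -!EFinM; congr (_%:E).
  rewrite normal_pdf01E normal_pdfE// [RHS]mulrA normal_peakM ?sqrtr_gt0//.
  rewrite mulrCA -expRD /normal_fun sqr_sqrtr// subr0; congr (_ * expR _).
  by rewrite -mulr_natr; field.
rewrite ge0_integralZl ?integral_normal_pdf ?mule1//.
- by apply/measurable_EFinP; exact: measurable_normal_pdf.
- by move=> x _; rewrite lee_fin normal_pdf_ge0.
Qed.

End gaussian_stability.

(** * Expectations of dominated functions, Fubini, and the Gaussian mean *)

Section gaussian_expectation.
Context {R : realType}.
Local Notation gamma := (@normal_prob R 0 1).
Local Notation gR := (measurableTypeR R).
Local Notation gamma2 := (gamma \x gamma)%E.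
Implicit Types (h : gR -> R) (k : gR * gR -> R).

(** A single majorant for all integrands: up to constants it dominates [|s|], [s^2] and [|s|^3], and
    its mean [sqrt 2] is explicit. Products of two such weights serve on the plane. *)
Definition gweight (s : R) : R := expR (s ^+ 2 / 4).

Lemma gweight_ge1 s : 1 <= gweight s.
Proof. by rewrite -expR0 ler_expR divr_ge0// sqr_ge0. Qed.

Lemma gweight_ge0 s : 0 <= gweight s.
Proof. exact: expR_ge0. Qed.

Lemma measurable_gweight : measurable_fun [set: gR] gweight.
Proof.
by apply: measurableT_comp => //; apply: measurable_funM.
Qed.

Lemma measurable_EFin_gweight (C : R) :
  measurable_fun [set: gR] (fun s : gR => (C * gweight s)%:E).
Proof.
by apply/measurable_EFinP; apply: measurable_funM => //; exact: measurable_gweight.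
Qed.

(** [(|s| / 2 - 1)^2 >= 0] gives [|s| <= 1 + s^2 / 4]. The factor 1 in front of the weight is the
    one that reaches the final constant. *)
Lemma norm_le_gweight s : `|s| <= gweight s.
Proof.
apply: le_trans (expR_ge1Dx _); rewrite -(real_normK (num_real s)).
by have := sqr_ge0 (`|s| / 2 - 1); lra.
Qed.

(** The cube of [|s| <= 2 exp (s^2 / 12)]; the third power is that of the Taylor remainder. *)
Lemma norm3_le_gweight s : `|s| ^+ 3 <= 8 * gweight s.
Proof.
have -> : gweight s = expR (s ^+ 2 / 12) ^+ 3.
  by rewrite -expRM_natl; congr expR; field.
have -> : 8 = 2 ^+ 3 :> R by ring.
rewrite -exprMn lerXn2r// ?nnegrE ?mulr_ge0 ?expR_ge0//.
apply: (@le_trans _ _ (2 * (1 + s ^+ 2 / 12))).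
  rewrite -(real_normK (num_real s)).
  by have := sqr_ge0 (`|s| - 3); nra.
by rewrite ler_wpM2l// expR_ge1Dx.
Qed.

Lemma gaussian_integrable C h : measurable_fun setT h ->
  (forall s, `|h s| <= C * gweight s) -> gamma.-integrable setT (EFin \o h).
Proof.
move=> mh hC; have C0 : 0 <= C.
  have /(le_trans (normr_ge0 _)) := hC 0.
  by rewrite pmulr_lge0// (lt_le_trans ltr01 (gweight_ge1 0)).
apply: (@le_integrable _ _ _ _ _ measurableT _ (EFin \o (fun s : gR => C * gweight s))).
- exact/measurable_EFinP.
- move=> s _ /=; rewrite lee_fin (le_trans (hC s))// ler_norm//.
- apply/integrableP; split.
    exact: measurable_EFin_gweight.
  under eq_integral do rewrite /= ger0_norm ?mulr_ge0 ?gweight_ge0// EFinM.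
  rewrite ge0_integralZl//=.
  - by rewrite integral_expR_sqr4 -EFinM ltry.
  - by apply/measurable_EFinP; exact: measurable_gweight.
  - by move=> s _; rewrite lee_fin gweight_ge0.
Qed.

Definition gexp h : R := \int[gamma]_s h s.

Lemma gexp_gweight : gexp gweight = Num.sqrt 2.
Proof. by rewrite /gexp /Rintegral integral_expR_sqr4. Qed.

Lemma integrable_gweight C : gamma.-integrable setT (EFin \o (fun s : gR => C * gweight s)).
Proof.
apply: (@gaussian_integrable `|C|).
  by apply: measurable_funM => //; exact: measurable_gweight.
by move=> s; rewrite normrM (ger0_norm (gweight_ge0 s)).
Qed.

Lemma gexp_cst c : gexp (fun=> c) = c.
Proof. by rewrite /gexp Rintegral_cst// [X in fine X]probability_setT mulr1. Qed.

Lemma le_gexp C D h1 h2 : measurable_fun setT h1 -> measurable_fun setT h2 ->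
  (forall s, `|h1 s| <= C * gweight s) -> (forall s, `|h2 s| <= D * gweight s) ->
  (forall s, h1 s <= h2 s) -> gexp h1 <= gexp h2.
Proof.
move=> m1 m2 b1 b2 h12; apply: le_Rintegral => //.
- exact: gaussian_integrable b1.
- exact: gaussian_integrable b2.
Qed.

Lemma gexpD C D h1 h2 : measurable_fun setT h1 -> measurable_fun setT h2 ->
  (forall s, `|h1 s| <= C * gweight s) -> (forall s, `|h2 s| <= D * gweight s) ->
  gexp (fun s => h1 s + h2 s) = gexp h1 + gexp h2.
Proof.
move=> m1 m2 b1 b2; apply: RintegralD => //.
- exact: gaussian_integrable b1.
- exact: gaussian_integrable b2.
Qed.

Lemma gexpZ C h c : measurable_fun setT h -> (forall s, `|h s| <= C * gweight s) ->
  gexp (fun s => c * h s) = c * gexp h.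
Proof.
by move=> m b; apply: RintegralZl => //; exact: gaussian_integrable b.
Qed.

Lemma norm_gexp_le C h : measurable_fun setT h ->
  (forall s, `|h s| <= C * gweight s) -> `|gexp h| <= C * Num.sqrt 2.
Proof.
move=> mh hC; have ih := gaussian_integrable mh hC.
apply: (le_trans (le_normr_Rintegral _ ih)) => //.
rewrite -gexp_gweight -RintegralZl//; last first.
  by have := integrable_gweight 1; under eq_fun do rewrite mul1r.
apply: le_Rintegral => //; last exact: integrable_gweight.
apply: (@gaussian_integrable C); first exact: measurableT_comp.
by move=> s; rewrite normr_id.
Qed.

Lemma measurable_section1 k s : measurable_fun setT k ->
  measurable_fun [set: gR] (fun t => k (s, t)).
Proof. by move=> mk; exact: measurableT_comp. Qed.

Lemma measurable_section2 k t : measurable_fun setT k ->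
  measurable_fun [set: gR] (fun s => k (s, t)).
Proof. by move=> mk; exact: measurableT_comp. Qed.

Lemma gaussian_integrable2 C k : measurable_fun setT k ->
  (forall s t, `|k (s, t)| <= C * gweight s * gweight t) ->
  gamma2.-integrable setT (EFin \o k).
Proof.
move=> mk kC; apply/integrable12ltyP; first exact/measurable_EFinP.
have C0 : 0 <= C.
  have /(le_trans (normr_ge0 _)) := kC 0 0.
  by rewrite /gweight expr0n mul0r expR0 !mulr1.
apply: (@le_lt_trans _ _ (\int[gamma]_s (C * Num.sqrt 2 * gweight s)%:E)%E).
  apply: ge0_le_integral => //.
  - by move=> s _; apply: integral_ge0.
  - apply: (measurable_fun_fubini_tonelli_F (abse \o (EFin \o k))) => //.
      by apply: measurableT_comp => //; exact/measurable_EFinP.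
    by move=> z; exact: abse_ge0.
  - exact: measurable_EFin_gweight.
  - move=> s _ /=.
    rewrite -gexp_gweight.
    apply: (@le_trans _ _ (\int[gamma]_t (C * gweight s * gweight t)%:E)%E).
      apply: ge0_le_integral => //.
      - by apply/measurable_EFinP/measurableT_comp => //; exact: measurable_section1.
      - exact: measurable_EFin_gweight.
      - by move=> t _; rewrite lee_fin.
    under eq_integral do rewrite EFinM.
    rewrite ge0_integralZl//.
    + by rewrite integral_expR_sqr4 -EFinM lee_fin gexp_gweight mulrAC.
    + by apply/measurable_EFinP; exact: measurable_gweight.
    + by move=> t _; rewrite lee_fin gweight_ge0.
    + by rewrite lee_fin mulr_ge0// gweight_ge0.
have /integrableP[_] := integrable_gweight (C * Num.sqrt 2).
apply: le_lt_trans; rewrite le_eqVlt; apply/orP; left; apply/eqP.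
apply: eq_integral => s _ /=.
by rewrite ger0_norm// !mulr_ge0// ?sqrtr_ge0// gweight_ge0.
Qed.

Lemma gexp12 C k : measurable_fun setT k ->
  (forall s t, `|k (s, t)| <= C * gweight s * gweight t) ->
  gexp (fun s => gexp (fun t => k (s, t))) =
  fine (\int[gamma2]_z (k z)%:E)%E.
Proof.
move=> mk kC; rewrite /gexp {1}/Rintegral; congr fine.
rewrite -(integral12_prod_meas1 (gaussian_integrable2 mk kC)).
apply: eq_integral => s _; rewrite /fubini_F/= /Rintegral fineK//.
apply: integrable_fin_num => //; apply: (@gaussian_integrable (C * gweight s)) => //.
exact: measurable_section1.
Qed.

Lemma gexp21 C k : measurable_fun setT k ->
  (forall s t, `|k (s, t)| <= C * gweight s * gweight t) ->
  gexp (fun t => gexp (fun s => k (s, t))) =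
  fine (\int[gamma2]_z (k z)%:E)%E.
Proof.
move=> mk kC; rewrite /gexp {1}/Rintegral; congr fine.
rewrite -(integral21_prod_meas1 (gaussian_integrable2 mk kC)).
apply: eq_integral => t _; rewrite /fubini_G/= /Rintegral fineK//.
apply: integrable_fin_num => //; apply: (@gaussian_integrable (C * gweight t)) => //.
  exact: measurable_section2.
by move=> s; rewrite mulrAC.
Qed.

(** Dividing [a] and [b] by [r] reduces to the normalised case. Since [h] is signed, the identity is
    proved for nonnegative functions and applied to its positive and negative parts; linear growth
    gives integrability on the plane. *)
Lemma gexp_convolution C h (a b : R) : measurable_fun setT h ->
  (forall y, `|h y| <= C * (1 + `|y|)) -> 0 < b ->
  gexp (fun s => gexp (fun t => h (a * s + b * t))) =
  gexp (fun s => h (Num.sqrt (a ^+ 2 + b ^+ 2) * s)).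
Proof.
move=> mh hC b0; set r := Num.sqrt _.
have ab0 : 0 < a ^+ 2 + b ^+ 2.
  by rewrite ltr_wpDl ?sqr_ge0// exprn_gt0.
have r0 : 0 < r by rewrite sqrtr_gt0.
have rn0 : r != 0 by rewrite gt_eqF.
have C0 : 0 <= C.
  have /(le_trans (normr_ge0 _)) := hC 0.
  by rewrite normr0 addr0 mulr1.
pose k (z : gR * gR) := h (a * z.1 + b * z.2).
have mk : measurable_fun setT k.
  apply: measurableT_comp => //; apply: measurable_funD => //.
    exact: measurable_funM.
  exact: measurable_funM.
rewrite (@gexp12 (C * (1 + `|a| + `|b|)) k)//; last first.
  move=> s t; rewrite /k/= (le_trans (hC _))// -!mulrA ler_wpM2l//.
  have s1 := gweight_ge1 s; have t1 := gweight_ge1 t.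
  have s2 := norm_le_gweight s; have t2 := norm_le_gweight t.
  have : `|a * s + b * t| <= `|a| * `|s| + `|b| * `|t|.
    by rewrite -!normrM ler_normD.
  have : gweight s <= gweight s * gweight t by rewrite ler_peMr ?gweight_ge0.
  have : gweight t <= gweight s * gweight t by rewrite ler_peMl ?gweight_ge0.
  have : `|a| * `|s| <= `|a| * gweight s by rewrite ler_wpM2l.
  have : `|b| * `|t| <= `|b| * gweight t by rewrite ler_wpM2l.
  move: (gweight s * gweight t) => w ? ? tw sw ?.
  have : `|a| * gweight s <= `|a| * w by rewrite ler_wpM2l.
  have : `|b| * gweight t <= `|b| * w by rewrite ler_wpM2l.
  lra.
have conv (H : gR -> \bar R) : measurable_fun setT H -> (forall y, 0 <= H y)%E ->
    (\int[gamma2]_z H (a * z.1 + b * z.2)%R =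
     \int[gamma]_s H (r * s)%R)%E.
  move=> mH H0.
  rewrite (@fubini_tonelli1 _ _ _ _ _ gamma gamma
    (fun z => H (a * z.1 + b * z.2)%R))//; last first.
    apply: measurableT_comp => //; apply: measurable_funD => //.
      exact: measurable_funM.
    exact: measurable_funM.
  rewrite /fubini_F/=.
  rewrite -[RHS](@ge0_integral_normal_prob_convolution _ (a / r) (b / r)
     (fun s => H (r * s)%R))//.
  - apply: eq_integral => s _; apply: eq_integral => t _; congr H.
    by field.
  - by rewrite divr_gt0.
  - rewrite !expr_div_n -mulrDl sqr_sqrtr ?ltW// divff// gt_eqF//.
  - by apply: measurableT_comp => //; exact: measurable_funM.
rewrite /gexp /Rintegral; congr fine.
rewrite [LHS]integralE [RHS]integralE; congr (_ - _)%E.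
- transitivity (\int[gamma2]_z ((EFin \o h)^\+ (a * z.1 + b * z.2)%R))%E.
    by apply: eq_integral => z _; rewrite !funeposE.
  rewrite conv; last 2 first.
    by apply: measurable_funepos; exact/measurable_EFinP.
    by move=> y; rewrite funepos_ge0.
  by apply: eq_integral => z _; rewrite !funeposE.
- transitivity (\int[gamma2]_z ((EFin \o h)^\- (a * z.1 + b * z.2)%R))%E.
    by apply: eq_integral => z _; rewrite !funenegE.
  rewrite conv; last 2 first.
    by apply: measurable_funeneg; exact/measurable_EFinP.
    by move=> y; rewrite funeneg_ge0.
  by apply: eq_integral => z _; rewrite !funenegE.
Qed.

(** If [m] is the mean, [s + t] has mean [2 m] but the law of [sqrt 2 * s], so
    [2 m = sqrt 2 * m]. *)
Lemma gexp_id : gexp id = 0.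
Proof.
have id_b s : `|s| <= 1 * gweight s by rewrite mul1r norm_le_gweight.
have mid : measurable_fun [set: gR] (id : R -> R) by [].
have Zid c : gexp (fun s => c * s) = c * gexp id.
  exact: (gexpZ _ mid id_b).
have shift s : gexp (fun t => 1 * s + 1 * t) = s + gexp id.
  rewrite -[X in X + _](gexp_cst s) -(@gexpD `|s| 1 (fun=> s) id)//.
    by congr gexp; apply/funext => t; rewrite !mul1r.
  by move=> t; rewrite ler_peMr// gweight_ge1.
have bound (y : R) : `|y| <= 1 * (1 + `|y|) by rewrite mul1r lerDr.
have := gexp_convolution 1 mid bound ltr01.
rewrite Zid expr1n.
under [X in gexp X]eq_fun do rewrite shift.
rewrite (@gexpD 1 `|gexp id| id (fun=> gexp id))//; last first.
  by move=> t; rewrite ler_peMr// gweight_ge1.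
rewrite gexp_cst => /eqP; rewrite -subr_eq0.
rewrite (_ : _ - _ = (2 - Num.sqrt (1 + 1)) * gexp id); last by ring.
rewrite mulf_eq0 => /orP[|/eqP//].
rewrite subr_eq0 => /eqP/(congr1 (fun x : R => x ^+ 2)).
by rewrite sqr_sqrtr//; lra.
Qed.

End gaussian_expectation.

(** * Gaussian averaging operators *)

Section gaussian_smoothing.
Context {R : realType} {V : finType}.
Local Notation gR := (measurableTypeR R).
Implicit Types (f : (V -> R) -> R) (a z : V -> R) (L : R).

(* Measurability is required along every family of measurable coordinates, as
   [V -> R] itself carries no measurable structure. *)
Definition sup_lipschitz L f : Prop :=
  [/\ 0 <= L,
   forall z z' c, 0 <= c -> (forall v, `|z v - z' v| <= c) ->
     `|f z - f z'| <= L * c &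
   forall d (Om : measurableType d) (h : V -> Om -> R),
     (forall v, measurable_fun setT (h v)) ->
     measurable_fun setT (fun w => f (fun v => h v w))].

Definition norm1 a : R := \sum_v `|a v|.

Lemma norm1_ge0 a : 0 <= norm1 a.
Proof. exact: sumr_ge0. Qed.

Lemma le_norm1 a v : `|a v| <= norm1 a.
Proof. by rewrite /norm1 (bigD1 v)//= lerDl sumr_ge0. Qed.

Definition smooth a f : (V -> R) -> R :=
  fun z => gexp (fun s => f (fun v => z v + s * a v)).

Section one_function.
Variables (L : R) (f : (V -> R) -> R).
Hypothesis fL : sup_lipschitz L f.

Let L0 : 0 <= L. Proof. by case: fL. Qed.

Lemma sup_lipschitz_line z a (s : R) :
  `|f (fun v => z v + s * a v) - f z| <= L * norm1 a * `|s|.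
Proof.
have [_ lip _] := fL; rewrite -mulrA; apply: lip.
  by rewrite mulr_ge0// norm1_ge0.
by move=> v; rewrite addrC addKr normrM mulrC ler_wpM2r// le_norm1.
Qed.

Lemma measurable_smooth_line z a :
  measurable_fun [set: gR] (fun s => f (fun v => z v + s * a v)).
Proof.
have [_ _ mf] := fL; apply: mf => v.
by apply: measurable_funD => //; exact: measurable_funM.
Qed.

Lemma smooth_bound z a (s : R) :
  `|f (fun v => z v + s * a v)| <= (`|f z| + L * norm1 a) * gweight s.
Proof.
have h := sup_lipschitz_line z a s; have w1 := gweight_ge1 s.
have h1 : L * norm1 a * `|s| <= L * norm1 a * gweight s.
  by rewrite ler_wpM2l ?norm_le_gweight// mulr_ge0// norm1_ge0.
have h2 : `|f z| <= `|f z| * gweight s by rewrite ler_peMr.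
rewrite mulrDl; apply: le_trans (lerD h2 (le_trans h h1)).
rewrite -[X in `|X| <= _](subrK (f z)) addrC; exact: ler_normD.
Qed.

Lemma smooth_plane_bound z a b (s t : R) :
  `|f (fun v => (z v + s * a v) + t * b v)| <=
  (`|f z| + L * norm1 a + L * norm1 b) * gweight s * gweight t.
Proof.
have w1 := gweight_ge1 s; have w2 := gweight_ge1 t.
have := smooth_bound z a s.
have := sup_lipschitz_line (fun v => z v + s * a v) b t.
set y := f _; set x := f _ => h1 h2.
have : `|y| <= `|x| + L * norm1 b * `|t|.
  by rewrite -lerBlDl (le_trans _ h1)// (le_trans (lerB_dist _ _))// .
have Lb0 : 0 <= L * norm1 b by rewrite mulr_ge0// norm1_ge0.
have h3 : L * norm1 b * `|t| <= L * norm1 b * gweight t.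
  by rewrite ler_wpM2l ?norm_le_gweight.
have h4 : L * norm1 b * gweight t <= L * norm1 b * gweight s * gweight t.
  by rewrite ler_wpM2r ?gweight_ge0// ler_peMr.
have h5 : `|x| <= (`|f z| + L * norm1 a) * gweight s * gweight t.
  by rewrite (le_trans h2)// ler_peMr// mulr_ge0 ?gweight_ge0// addr_ge0//
    mulr_ge0// norm1_ge0.
by rewrite !mulrDl in h5 *; lra.
Qed.

(** The constant [L] does not grow, so smoothings can be iterated any number of times. *)
Lemma sup_lipschitz_smooth a : sup_lipschitz L (smooth a f).
Proof.
have [_ lip mf] := fL; split => //.
- move=> z z' c c0 zz'; rewrite /smooth.
  rewrite -mulN1r -(gexpZ _ (measurable_smooth_line z' a) (smooth_bound z' a)).
  rewrite -(gexpD (measurable_smooth_line z a) _ (smooth_bound z a)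
    (D := `|f z'| + L * norm1 a)); last 2 first.
  + by apply: measurable_funM => //; exact: measurable_smooth_line.
  + by move=> s; rewrite mulN1r normrN; exact: smooth_bound.
  have md : measurable_fun [set: gR] (fun s => f (fun v => z v + s * a v) +
      -1 * f (fun v => z' v + s * a v)).
    apply: measurable_funD; first exact: measurable_smooth_line.
    by apply: measurable_funM => //; exact: measurable_smooth_line.
  have bd s : `|f (fun v => z v + s * a v) + -1 * f (fun v => z' v + s * a v)|
      <= L * c.
    rewrite mulN1r; apply: lip => // v.
    by rewrite opprD addrACA subrr addr0.
  have bd' s : `|f (fun v => z v + s * a v) + -1 * f (fun v => z' v + s * a v)|
      <= L * c * gweight s.
    by rewrite (le_trans (bd s))// ler_peMr ?gweight_ge1// mulr_ge0.
  have cb k (s : R) : `|k| <= `|k| * gweight s by rewrite ler_peMr ?gweight_ge1.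
  rewrite ler_norml; apply/andP; split.
  + rewrite -[X in X <= _]gexp_cst; apply: (@le_gexp _ `|- (L * c)| (L * c) (fun=> - (L * c)) _ _ md) => //.
    by move=> s; have := bd s; rewrite ler_norml => /andP[].
  + rewrite -[X in _ <= X]gexp_cst; apply: (@le_gexp _ (L * c) `|L * c| _ (fun=> L * c) md) => //.
    by move=> s; have := bd s; rewrite ler_norml => /andP[].
- move=> d Om h mh; rewrite /smooth /gexp /Rintegral.
  pose k (x : Om * gR) : \bar R := (f (fun v => h v x.1 + x.2 * a v))%:E.
  have mk : measurable_fun setT k.
    apply/measurable_EFinP; apply: (mf _ _ (fun v (x : Om * gR) => h v x.1 + x.2 * a v)) => v.
    apply: measurable_funD; first exact: measurableT_comp.
    by apply: measurable_funM => //.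
  apply: measurableT_comp => //.
  (* Measurability of a partial integral comes from Tonelli, hence the two nonnegative parts. *)
  rewrite (_ : (fun _ => _) = (fun w => fubini_F (normal_prob 0 1) (k^\+) w -
      fubini_F (normal_prob 0 1) (k^\-) w)%E); last first.
    apply/funext => w; rewrite integralE /fubini_F; congr (_ - _)%E.
      by apply: eq_integral => s _; rewrite !funeposE.
    by apply: eq_integral => s _; rewrite !funenegE.
  apply: emeasurable_funB; apply: measurable_fun_fubini_tonelli_F.
  + exact: measurable_funepos.
  + by move=> x; rewrite funepos_ge0.
  + exact: measurable_funeneg.
  + by move=> x; rewrite funeneg_ge0.
Qed.

Lemma smoothC a b : smooth a (smooth b f) = smooth b (smooth a f).
Proof.
apply/funext => z.
pose k (x : gR * gR) : R := f (fun v => z v + x.1 * a v + x.2 * b v).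
have mk : measurable_fun setT k.
  have [_ _ mf] := fL.
  apply: (mf _ _ (fun v (x : gR * gR) => z v + x.1 * a v + x.2 * b v)) => v.
  apply: measurable_funD; last exact: measurable_funM.
  by apply: measurable_funD => //; exact: measurable_funM.
have bk := smooth_plane_bound z a b.
rewrite /smooth.
transitivity (fine (\int[(normal_prob 0 1 \x normal_prob 0 1)%E]_x (k x)%:E)%E).
  exact: (gexp12 mk bk).
rewrite -(gexp21 mk bk); congr gexp; apply/funext => t; congr gexp.
apply/funext => s; rewrite /k/=; congr f; apply/funext => v.
by rewrite addrAC.
Qed.

(** Independent Gaussian steps along one direction add their variances. *)
Lemma smooth_merge a (l m : R) : 0 < m ->
  smooth (l \*o a) (smooth (m \*o a) f) = smooth (Num.sqrt (l ^+ 2 + m ^+ 2) \*o a) f.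
Proof.
move=> m0; apply/funext => z; rewrite /smooth.
pose h (y : gR) := f (fun v => z v + y * a v).
transitivity (gexp (fun s => gexp (fun t => h (l * s + m * t)))).
  congr gexp; apply/funext => s; congr gexp; apply/funext => t.
  by congr f; apply/funext => v /=; ring.
rewrite (@gexp_convolution _ (`|f z| + L * norm1 a))//.
- congr gexp; apply/funext => s; congr f; apply/funext => v /=; ring.
- exact: measurable_smooth_line.
- move=> y; have := sup_lipschitz_line z a y; rewrite -/(h y).
  have La0 : 0 <= L * norm1 a by rewrite mulr_ge0// norm1_ge0.
  have y0 : 0 <= `|f z| * `|y| by rewrite mulr_ge0.
  move=> H; have : `|h y| <= `|f z| + L * norm1 a * `|y|.
    by rewrite -lerBlDl (le_trans _ H)// (le_trans (lerB_dist _ _)).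
  by lra.
Qed.

End one_function.

Lemma le_smooth L L' f f' a z : sup_lipschitz L f -> sup_lipschitz L' f' ->
  (forall y, f y <= f' y) -> smooth a f z <= smooth a f' z.
Proof.
move=> fL fL' ff'; apply: (le_gexp (measurable_smooth_line fL z a)
  (measurable_smooth_line fL' z a) (smooth_bound fL z a) (smooth_bound fL' z a)).
by move=> s.
Qed.

Lemma smooth_addc L f a (c : R) : sup_lipschitz L f ->
  smooth a (fun z => f z + c) = (fun z => smooth a f z + c).
Proof.
move=> fL; apply/funext => z; rewrite /smooth -[in RHS](gexp_cst c).
rewrite -(gexpD (measurable_smooth_line fL z a) _ (smooth_bound fL z a)
  (D := `|c|))// => s.
by rewrite ler_peMr ?gweight_ge1.
Qed.

Lemma sup_lipschitz_addc L f (c : R) : sup_lipschitz L f ->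
  sup_lipschitz L (fun z => f z + c).
Proof.
move=> [L0 lip mf]; split => //.
- by move=> z z' d d0 zz'; rewrite opprD addrACA subrr addr0; exact: lip.
- by move=> d Om h mh; apply: measurable_funD => //; exact: mf.
Qed.

Definition smooths (l : seq (V -> R)) f := foldr smooth f l.

Lemma sup_lipschitz_smooths L f l : sup_lipschitz L f ->
  sup_lipschitz L (smooths l f).
Proof. by move=> fL; elim: l => //= a l IH; exact: sup_lipschitz_smooth. Qed.

Lemma smooths_cat l l' f : smooths (l ++ l') f = smooths l (smooths l' f).
Proof. exact: foldr_cat. Qed.

Lemma smooth_smoothsC L f a l : sup_lipschitz L f ->
  smooth a (smooths l f) = smooths l (smooth a f).
Proof.
move=> fL; elim: l => //= b l <-.
exact: (smoothC (sup_lipschitz_smooths l fL)).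
Qed.

Lemma smoothsC L f l l' : sup_lipschitz L f ->
  smooths l (smooths l' f) = smooths l' (smooths l f).
Proof.
move=> fL; elim: l => //= a l ->.
exact: (smooth_smoothsC a l' (sup_lipschitz_smooths l fL)).
Qed.

Lemma le_smooths L L' f f' l z : sup_lipschitz L f -> sup_lipschitz L' f' ->
  (forall y, f y <= f' y) -> smooths l f z <= smooths l f' z.
Proof.
move=> fL fL' ff'; elim: l z => //= a l IH z.
by apply: (le_smooth _ _ (sup_lipschitz_smooths l fL) (sup_lipschitz_smooths l fL')).
Qed.

Lemma smooths_addc L f l (c : R) : sup_lipschitz L f ->
  smooths l (fun z => f z + c) = (fun z => smooths l f z + c).
Proof.
move=> fL; elim: l => //= a l ->.
exact: (smooth_addc _ _ (sup_lipschitz_smooths l fL)).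
Qed.

Lemma sup_lipschitz_iter_smooths L f l n : sup_lipschitz L f ->
  sup_lipschitz L (iter n (smooths l) f).
Proof. by move=> fL; elim: n => //= n IH; exact: sup_lipschitz_smooths. Qed.

Lemma iter_smooths_comm L f l l' n : sup_lipschitz L f ->
  iter n (smooths l) (smooths l' f) = smooths l' (iter n (smooths l) f).
Proof.
move=> fL; elim: n => //= n ->; apply: smoothsC.
exact: (sup_lipschitz_iter_smooths _ _ fL).
Qed.

Lemma iter_smooth L f a n : sup_lipschitz L f ->
  iter n.+1 (smooth a) f = smooth (Num.sqrt n.+1%:R \*o a) f.
Proof.
move=> fL; elim: n => [|n IH].
  by rewrite /= sqrtr1; congr (smooth _ f); apply/funext => v /=; rewrite mul1r.
rewrite iterS IH.
rewrite [X in smooth X _](_ : a = 1 \*o a); last first.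
  by apply/funext => v /=; rewrite mul1r.
rewrite (smooth_merge fL) ?sqrtr_gt0//; congr (smooth (_ \*o a) f).
by rewrite sqr_sqrtr// expr1n [in RHS]mulrS.
Qed.

(** All smoothings commute, so the rounds can be regrouped direction by direction, and each
    direction merges into one step. *)
Lemma iter_smooths L f l n : sup_lipschitz L f ->
  iter n.+1 (smooths l) f = smooths [seq Num.sqrt n.+1%:R \*o a | a <- l] f.
Proof.
move=> fL; elim: l => [|a l IH]; first by elim: n => //= n ->.
rewrite [RHS]/= -IH -(@iter_smooth L)//; last exact: sup_lipschitz_iter_smooths.
elim: n.+1 => // m IHm; rewrite !iterS IHm /=; congr (smooth _ _).
(* It remains to carry one [smooths l] across [m] smoothings along [a]. *)
have := @sup_lipschitz_iter_smooths L f l m fL.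
move: (iter m (smooths l) f) => g gL.
elim: m {IHm} => // m IHm; rewrite !iterS -IHm.
rewrite (@smooth_smoothsC L)//.
elim: m {IHm} => //= m IHm; exact: sup_lipschitz_smooth.
Qed.

End gaussian_smoothing.

(** * The log-sum-exp function *)

Section mean_value_bounds.
Context {R : realType}.
Implicit Types f g : R -> R.

Lemma is_derive1_continuous f (f' : R -> R) :
  (forall x : R, is_derive x 1 f (f' x)) -> continuous f.
Proof.
move=> df x; apply/differentiable_continuous/derivable1_diffP.
by have [] := df x.
Qed.

Lemma mean_value_bound f (f' : R -> R) (s K : R) :
  (forall x : R, is_derive x 1 f (f' x)) ->
  (forall x, `|x| <= `|s| -> `|f' x| <= K) -> `|f s - f 0| <= K * `|s|.
Proof.
move=> df fK; have cf := is_derive1_continuous df.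
have [s0|s0] := leP 0 s.
  have [c /[!in_itv]/= /andP[c0 cs] ->] :=
    MVT_segment s0 (fun x _ => df x) (continuous_subspaceT cf).
  rewrite subr0 normrM ler_wpM2r//; apply: fK.
  by rewrite !ger0_norm.
have [c /[!in_itv]/= /andP[sc c0]] :=
  MVT_segment (ltW s0) (fun x _ => df x) (continuous_subspaceT cf).
rewrite sub0r distrC => ->; rewrite normrM normrN ler_wpM2r//; apply: fK.
by rewrite !ler0_norm ?lerN2// ltW.
Qed.

Lemma is_derive1_ext f g (x d d' : R) : is_derive x 1 f d -> f =1 g -> d = d' ->
  is_derive x 1 g d'.
Proof. by move=> df /funext <- <-. Qed.

Lemma is_derive1_linear (c x : R) : is_derive x 1 (fun y : R => y * c) c.
Proof.
have := @is_deriveZ _ _ _ id c x 1 1 (is_derive_id x 1).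
move=> /is_derive1_ext; apply.
  by move=> y; rewrite mulrC.
by rewrite /GRing.scale/= mulr1.
Qed.

(** The mean value bound is applied twice, to [f'] minus its tangent and then to [f] minus its
    second-order polynomial, so the constant is [M] rather than [M / 6]. *)
Lemma taylor_bound f (f' f'' : R -> R) (M s : R) :
  (forall x : R, is_derive x 1 f (f' x)) ->
  (forall x : R, is_derive x 1 f' (f'' x)) ->
  (forall x, `|f'' x - f'' 0| <= M * `|x|) ->
  `|f s - f 0 - s * f' 0 - s ^+ 2 * (f'' 0 / 2)| <= M * `|s| ^+ 3.
Proof.
move=> df df' fM.
have M0 : 0 <= M by have := fM 1; rewrite normr1 mulr1; exact: le_trans.
pose g (x : R) := f' x - x * f'' 0.
have dg (x : R) : is_derive x 1 g (f'' x - f'' 0).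
  by apply: is_deriveB; exact: is_derive1_linear.
pose h (x : R) := f x - x * f' 0 - x ^+ 2 * (f'' 0 / 2).
have dh (x : R) : is_derive x 1 h (f' x - f' 0 - x * f'' 0).
  apply: is_deriveB; first by apply: is_deriveB; exact: is_derive1_linear.
  have := @is_deriveM _ _ (fun y : R => y) (fun y : R => y * (f'' 0 / 2)) x 1 1
    (f'' 0 / 2) (is_derive_id x 1) (is_derive1_linear _ x).
  move=> /is_derive1_ext; apply; first by move=> y; rewrite expr2 -mulrA.
  by rewrite /GRing.scale/=; field.
have gM x : `|f' x - f' 0 - x * f'' 0| <= M * `|x| ^+ 2.
  have := mean_value_bound dg (s := x) (K := M * `|x|).
  rewrite /g mul0r subr0 addrAC expr2 mulrA; apply => y yx.
  by rewrite (le_trans (fM y))// ler_wpM2l.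
have := mean_value_bound dh (s := s) (K := M * `|s| ^+ 2).
have -> : h s - h 0 = f s - f 0 - s * f' 0 - s ^+ 2 * (f'' 0 / 2).
  by rewrite /h; ring.
rewrite (_ : M * `|s| ^+ 3 = M * `|s| ^+ 2 * `|s|); last by ring.
apply => y yx; rewrite (le_trans (gM y))// ler_wpM2l// lerXn2r// nnegrE.
Qed.

Lemma is_derive1_bigsum (I : Type) (r : seq I) (h : I -> R -> R) (dh : I -> R)
    (x : R) : (forall i, is_derive x 1 (h i) (dh i)) ->
  is_derive x 1 (fun s => \sum_(i <- r) h i s) (\sum_(i <- r) dh i).
Proof.
move=> dhi; elim: r => [|i r IH].
  rewrite big_nil; under eq_fun do rewrite big_nil; exact: is_derive_cst.
rewrite big_cons; under eq_fun do rewrite big_cons; exact: is_deriveD.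
Qed.

End mean_value_bounds.

Section log_sum_exp.
Context {R : realType} {V : finType} (v0 : V).
Implicit Types (a z : V -> R).

Definition lse z : R := ln (\sum_v expR (z v)).
(** The softmax weights, that is the gradient of [lse]; in exponential form they are differentiated
    by the chain rule, without a quotient. *)
Definition gibbs z v : R := expR (z v - lse z).
Definition gmean a z : R := \sum_v gibbs z v * a v.
(** The variance of [a] under the weights [gibbs z], in the shape in which it arises as the
    derivative of [gmean a] along [a]. *)
Definition gvar a z : R := \sum_v gibbs z v * (a v * (a v - gmean a z)).

Lemma sum_expR_gt0 z : 0 < \sum_v expR (z v).
Proof. by rewrite (bigD1 v0)//= ltr_wpDr ?expR_gt0// sumr_ge0// => v _; rewrite expR_ge0. Qed.

Lemma gibbs_ge0 z v : 0 <= gibbs z v.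
Proof. exact: expR_ge0. Qed.

Lemma gibbsE z v : gibbs z v = expR (z v) / \sum_w expR (z w).
Proof. by rewrite /gibbs expRD expRN lnK// posrE sum_expR_gt0. Qed.

Lemma sum_gibbs z : \sum_v gibbs z v = 1.
Proof.
under eq_bigr do rewrite gibbsE.
by rewrite -mulr_suml divff// gt_eqF// sum_expR_gt0.
Qed.

Lemma gibbs_le1 z v : gibbs z v <= 1.
Proof.
rewrite -(sum_gibbs z) (bigD1 v)//= lerDl sumr_ge0// => w _; exact: gibbs_ge0.
Qed.

Lemma norm_gmean_le a z c : (forall v, `|a v| <= c) -> `|gmean a z| <= c.
Proof.
move=> ac; rewrite (le_trans (ler_norm_sum _ _ _))//.
rewrite -[leRHS]mul1r -(sum_gibbs z) mulr_suml; apply: ler_sum => v _.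
by rewrite normrM (ger0_norm (gibbs_ge0 _ _)) ler_wpM2l// gibbs_ge0.
Qed.

Lemma is_derive_line (c d x : R) : is_derive x 1 (fun s : R => c + s * d) d.
Proof.
have := is_deriveD (is_derive_cst c x (1 : R)) (is_derive1_linear d x).
by rewrite add0r.
Qed.

Lemma is_derive_lse z a (x : R) :
  is_derive x 1 (fun s => lse (fun v => z v + s * a v))
    (gmean a (fun v => z v + x * a v)).
Proof.
have dE v : is_derive x 1 (fun s => expR (z v + s * a v))
    (expR (z v + x * a v) * a v).
  apply: (@is_derive1_comp _ expR (fun s => z v + s * a v) x).
  exact: is_derive_line.
have dS := is_derive1_bigsum (index_enum V) dE.
have S0 := sum_expR_gt0 (fun v => z v + x * a v).
have := @is_derive1_comp _ (@ln R) (fun s => \sum_v expR (z v + s * a v)) x _ _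
  (is_derive1_ln S0) dS.
move=> /is_derive1_ext; apply => //.
rewrite mulr_sumr; apply: eq_bigr => v _.
by rewrite gibbsE; ring.
Qed.

Lemma is_derive_gibbs z a v (x : R) :
  is_derive x 1 (fun s => gibbs (fun v => z v + s * a v) v)
    (gibbs (fun v => z v + x * a v) v * (a v - gmean a (fun v => z v + x * a v))).
Proof.
apply: (@is_derive1_comp _ expR
  (fun s => z v + s * a v - lse (fun v => z v + s * a v)) x).
by apply: is_deriveB; [exact: is_derive_line|exact: is_derive_lse].
Qed.

Lemma is_derive_gmean z a b (x : R) :
  is_derive x 1 (fun s => gmean b (fun v => z v + s * a v))
    (\sum_v gibbs (fun v => z v + x * a v) v *
      (b v * (a v - gmean a (fun v => z v + x * a v)))).
Proof.
have db v := is_deriveM (is_derive_gibbs z a v x) (is_derive_cst (b v) x (1 : R)).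
have /is_derive1_ext := is_derive1_bigsum (index_enum V) db; apply => //.
by apply: eq_bigr => v _; rewrite /GRing.scale/= mulr0 add0r; ring.
Qed.

Let segment z z' v : z v + (z' v - z v) = z' v. Proof. by rewrite addrC subrK. Qed.

Lemma lse_lipschitz z z' c : (forall v, `|z v - z' v| <= c) ->
  `|lse z - lse z'| <= c.
Proof.
move=> zz'.
have := mean_value_bound (is_derive_lse z' (fun v => z v - z' v)) (s := 1) (K := c).
rewrite normr1 mulr1 (_ : (fun v => z' v + 1 * _) = z); last first.
  by apply/funext => v; rewrite mul1r segment.
rewrite (_ : (fun v => z' v + 0 * _) = z'); last first.
  by apply/funext => v; rewrite mul0r addr0.
by apply => x _; exact: norm_gmean_le.
Qed.

(** The 2 bounds the deviation of a coordinate from its mean; the weight itself is at most 1. *)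
Lemma gibbs_lipschitz z z' v c : (forall v, `|z v - z' v| <= c) ->
  `|gibbs z v - gibbs z' v| <= 2 * c.
Proof.
move=> zz'.
have := mean_value_bound (is_derive_gibbs z' (fun v => z v - z' v) v)
  (s := 1) (K := 2 * c).
rewrite normr1 mulr1 (_ : (fun v => z' v + 1 * _) = z); last first.
  by apply/funext => w; rewrite mul1r segment.
rewrite (_ : (fun v => z' v + 0 * _) = z'); last first.
  by apply/funext => w; rewrite mul0r addr0.
apply => x _; rewrite normrM (ger0_norm (gibbs_ge0 _ _)).
set y := (fun v : V => _ + x * _).
have := norm_gmean_le y zz'; have := zz' v; have := gibbs_le1 y v.
have := gibbs_ge0 y v.
have := ler_normB (z v - z' v) (gmean (fun v => z v - z' v) y).
set n := `|_ - gmean _ _| => h0 h1 h2 h3 h4.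
rewrite -[leRHS]mul1r; apply: ler_pM => //; first exact: normr_ge0.
by rewrite (le_trans h0)//; lra.
Qed.

Lemma measurable_lse d (Om : measurableType d) (h : V -> Om -> R) :
  (forall v, measurable_fun setT (h v)) ->
  measurable_fun setT (fun w => lse (fun v => h v w)).
Proof.
move=> mh; apply: measurableT_comp => //.
apply: measurable_sum => v; exact: measurableT_comp.
Qed.

Lemma sup_lipschitz_lse : sup_lipschitz 1 (@lse).
Proof.
split => //; first by move=> z z' c c0 zz'; rewrite mul1r; exact: lse_lipschitz.
exact: measurable_lse.
Qed.

Lemma measurable_gibbs d (Om : measurableType d) (h : V -> Om -> R) v :
  (forall v, measurable_fun setT (h v)) ->
  measurable_fun setT (fun w => gibbs (fun v => h v w) v).
Proof.
move=> mh; apply: measurableT_comp => //.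
by apply: measurable_funB => //; exact: measurable_lse.
Qed.

Lemma measurable_gmean a d (Om : measurableType d) (h : V -> Om -> R) :
  (forall v, measurable_fun setT (h v)) ->
  measurable_fun setT (fun w => gmean a (fun v => h v w)).
Proof.
move=> mh; apply: measurable_sum => v; apply: measurable_funM => //.
exact: measurable_gibbs.
Qed.

(** Only differences of coordinates survive, which lets a hypothesis on increments act on the
    Hessian. The square is expanded and the weights sum to 1. *)
Lemma gvarE a z :
  gvar a z = 2^-1 * \sum_v \sum_w gibbs z v * gibbs z w * (a v - a w) ^+ 2.
Proof.
have e1 : \sum_v \sum_w gibbs z v * gibbs z w * (a v ^+ 2) =
    \sum_v gibbs z v * a v ^+ 2.
  apply: eq_bigr => v _; under eq_bigr do rewrite mulrAC.
  by rewrite -mulr_sumr sum_gibbs mulr1.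
have e2 : \sum_v \sum_w gibbs z v * gibbs z w * (a w ^+ 2) =
    \sum_v gibbs z v * a v ^+ 2.
  rewrite exchange_big -e1; apply: eq_bigr => v _; apply: eq_bigr => w _; ring.
have e3 : \sum_v \sum_w gibbs z v * gibbs z w * (a v * a w) = gmean a z ^+ 2.
  rewrite expr2 {1}/gmean mulr_suml; apply: eq_bigr => v _.
  rewrite mulr_sumr; apply: eq_bigr => w _; ring.
have -> : \sum_v \sum_w gibbs z v * gibbs z w * (a v - a w) ^+ 2 =
    \sum_v gibbs z v * a v ^+ 2 + \sum_v gibbs z v * a v ^+ 2 - 2 * gmean a z ^+ 2.
  rewrite -{1}e1 -e2 -e3 mulr_sumr -big_split -sumrB; apply: eq_bigr => v _.
  rewrite mulr_sumr -big_split -sumrB; apply: eq_bigr => w _ /=; ring.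
rewrite /gvar; under eq_bigr do rewrite mulrBr mulrBr -expr2.
rewrite sumrB.
under [X in _ - X]eq_bigr do rewrite mulrA.
by rewrite -mulr_suml -/(gmean a z); field.
Qed.

Lemma gvarZ (e : R) a z : gvar (e \*o a) z = e ^+ 2 * gvar a z.
Proof.
rewrite !gvarE mulrCA; congr (_ * _); rewrite mulr_sumr; apply: eq_bigr => v _.
by rewrite mulr_sumr; apply: eq_bigr => w _ /=; ring.
Qed.

(** The 6 is [4 + 2]: [2 c] times [2 N] from the change of weight, and [2 N c] from the change of
    mean. *)
Lemma variance_term_bound (g g' x m m' N c : R) :
  `|g - g'| <= 2 * c -> 0 <= g' -> g' <= 1 -> `|x| <= N -> `|m| <= N ->
  `|m - m'| <= 2 * N * c ->
  `|g * (x * (x - m)) - g' * (x * (x - m'))| <= `|x| * (6 * N * c).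
Proof.
move=> h1 g0 g1 xN mN h2.
have -> : g * (x * (x - m)) - g' * (x * (x - m')) =
    x * ((g - g') * (x - m) - g' * (m - m')) by ring.
rewrite normrM ler_wpM2l// (le_trans (ler_normB _ _))// !normrM (ger0_norm g0).
have h3 : `|x - m| <= 2 * N.
  by rewrite (le_trans (ler_normB _ _))// mulr_natl mulr2n lerD.
have := ler_pM (normr_ge0 _) (normr_ge0 _) h1 h3.
have := ler_pM g0 (normr_ge0 _) g1 h2.
by rewrite mul1r; lra.
Qed.

Lemma sup_lipschitz_gvar a : sup_lipschitz (6 * norm1 a ^+ 2) (gvar a).
Proof.
have N0 := norm1_ge0 a; set N := norm1 a in N0 *.
split; first by rewrite mulr_ge0// sqr_ge0.
- move=> z z' c c0 zz'.
  have dm : `|gmean a z - gmean a z'| <= 2 * N * c.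
    rewrite -sumrB (le_trans (ler_norm_sum _ _ _))//.
    rewrite mulrAC /N mulr_sumr; apply: ler_sum => v _.
    by rewrite -mulrBl normrM ler_wpM2r// gibbs_lipschitz.
  have m_le y : `|gmean a y| <= N by apply: norm_gmean_le; exact: le_norm1.
  rewrite -sumrB (le_trans (ler_norm_sum _ _ _))//.
  rewrite (_ : 6 * N ^+ 2 * c = \sum_v `|a v| * (6 * N * c)); last first.
    by rewrite -mulr_suml -/(norm1 a) -/N; ring.
  apply: ler_sum => v _.
  apply: variance_term_bound => //.
  + exact: gibbs_lipschitz.
  + exact: gibbs_ge0.
  + exact: gibbs_le1.
  + exact: le_norm1.
- move=> d Om h mh; apply: measurable_sum => v; apply: measurable_funM.
    exact: measurable_gibbs.
  apply: measurable_funM => //; apply: measurable_funB => //.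
  exact: measurable_gmean.
Qed.

(** [gvar a] is the second derivative along [a], and along that line its Lipschitz constant is
    [6 * norm1 a ^+ 2] times [norm1 a]. *)
Lemma lse_taylor z a (s : R) :
  `|lse (fun v => z v + s * a v) - lse z - s * gmean a z - s ^+ 2 * (gvar a z / 2)|
  <= 6 * norm1 a ^+ 3 * `|s| ^+ 3.
Proof.
have lip (x : R) : `|gvar a (fun v => z v + x * a v) -
    gvar a (fun v => z v + 0 * a v)| <= 6 * norm1 a ^+ 3 * `|x|.
  have [_ lip _] := sup_lipschitz_gvar a.
  rewrite (le_trans (lip _ _ (norm1 a * `|x|) _ _))//.
  - by rewrite mulr_ge0// norm1_ge0.
  - move=> v; rewrite mul0r addr0 addrC addKr normrM mulrC ler_wpM2r//.
    exact: le_norm1.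
  - by rewrite exprSr !mulrA.
have := taylor_bound s (is_derive_lse z a) (is_derive_gmean z a a) lip.
have -> // : (fun v => z v + 0 * a v) = z.
by apply/funext => v; rewrite mul0r addr0.
Qed.

End log_sum_exp.

(** * The Sudakov-Fernique inequality *)

Section comparison.
Context {R : realType} {V : finType} (v0 : V).
Local Notation gR := (measurableTypeR R).
Local Notation kappa := (gexp (fun s : R => s ^+ 2)).
Implicit Types (a z : V -> R) (l : seq (V -> R)).

Lemma measurable_sqr : measurable_fun [set: gR] (fun s : R => s ^+ 2).
Proof. exact: measurable_funX. Qed.

Lemma sqr_le_gweight (s : R) : `|s ^+ 2| <= 4 * gweight s.
Proof.
rewrite ger0_norm ?sqr_ge0//; have := expR_ge1Dx (s ^+ 2 / 4).
by rewrite -/(gweight s); lra.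
Qed.

(** The second moment stays an unevaluated constant: it scales the second-order terms of both
    processes alike, so its sign is enough. *)
Lemma kappa_ge0 : 0 <= kappa.
Proof. by apply: Rintegral_ge0 => s _; exact: sqr_ge0. Qed.

Lemma norm1Z (e : R) a : norm1 (e \*o a) = `|e| * norm1 a.
Proof. by rewrite /norm1 mulr_sumr; apply: eq_bigr => v _; rewrite normrM. Qed.

Lemma sup_lipschitzD L L' (f f' : (V -> R) -> R) :
  sup_lipschitz L f -> sup_lipschitz L' f' ->
  sup_lipschitz (L + L') (fun z => f z + f' z).
Proof.
move=> [L0 lip mf] [L'0 lip' mf']; split; first exact: addr_ge0.
- move=> z z' c c0 zz'; rewrite opprD addrACA (le_trans (ler_normD _ _))//.
  by rewrite mulrDl lerD ?lip ?lip'.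
- by move=> d Om h mh; apply: measurable_funD; [exact: mf|exact: mf'].
Qed.

Lemma sup_lipschitzZ L (f : (V -> R) -> R) (c : R) : sup_lipschitz L f ->
  sup_lipschitz (`|c| * L) (fun z => c * f z).
Proof.
move=> [L0 lip mf]; split; first exact: mulr_ge0.
- move=> z z' d d0 zz'; rewrite -mulrBr normrM -mulrA ler_wpM2l//; exact: lip.
- by move=> d Om h mh; apply: measurable_funM => //; exact: mf.
Qed.

Lemma sup_lipschitz_cst (c : R) : sup_lipschitz 0 (fun _ : V -> R => c).
Proof. by split => // z z' d d0 _; rewrite subrr normr0 mul0r. Qed.

Lemma smoothD L L' (f f' : (V -> R) -> R) a (c : R) z :
  sup_lipschitz L f -> sup_lipschitz L' f' ->
  smooth a (fun z => f z + c * f' z) z = smooth a f z + c * smooth a f' z.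
Proof.
move=> fL fL'; rewrite /smooth.
have mf' := measurable_smooth_line fL' z a.
have cf' s : `|c * f' (fun v => z v + s * a v)| <=
    (`|c| * (`|f' z| + L' * norm1 a)) * gweight s.
  by rewrite normrM -mulrA ler_wpM2l// (smooth_bound fL').
rewrite -(gexpZ c mf' (smooth_bound fL' z a)).
apply: (gexpD (measurable_smooth_line fL z a) _ (smooth_bound fL z a) cf').
exact: measurable_funM.
Qed.

Lemma smooth_approx L (f : (V -> R) -> R) a z : sup_lipschitz L f ->
  `|smooth a f z - f z| <= L * norm1 a * Num.sqrt 2.
Proof.
move=> fL; rewrite /smooth.
have mf := measurable_smooth_line fL z a.
have bf s : `|f (fun v => z v + s * a v) + - f z| <= L * norm1 a * gweight s.
  have [L0 _ _] := fL.
  rewrite (le_trans (sup_lipschitz_line fL z a s))// ler_wpM2l ?norm_le_gweight//.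
  by rewrite mulr_ge0// norm1_ge0.
rewrite -[X in _ - X]gexp_cst -[X in _ + X]mulN1r -(@gexpZ _ `|f z|)//; last first.
  by move=> s; rewrite ler_peMr// gweight_ge1.
rewrite -(@gexpD _ _ `|f z| _ _ mf _ (smooth_bound fL z a))//; last first.
  by move=> s; rewrite mulN1r normrN ler_peMr// gweight_ge1.
apply: norm_gexp_le; first exact: measurable_funD.
by move=> s; rewrite mulN1r; exact: bf.
Qed.

(** Averaging the expansion kills the linear term and puts the second moment in the quadratic one.
    In the remainder [48 = 6 * 8], the 8 coming from the bound of [|s|^3] by the weight, and
    [sqrt 2] is the mean of the weight. *)
Lemma smooth_lse_taylor a z :
  `|smooth a lse z - lse z - kappa / 2 * gvar a z| <=
  48 * norm1 a ^+ 3 * Num.sqrt 2.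
Proof.
have lL := sup_lipschitz_lse (R := R) v0.
have mf := measurable_smooth_line lL z a; have bf := smooth_bound lL z a.
set m := gmean a z; set q := gvar a z / 2.
(* The Taylor remainder, written as a nested sum so that linearity of [gexp] applies term by
   term. *)
pose r s : R := lse (fun v => z v + s * a v) + (- lse z + (- m * s + - q * s ^+ 2)).
have mid : measurable_fun [set: gR] (id : R -> R) by [].
have bid (s : R) : `|s| <= 1 * gweight s by rewrite mul1r norm_le_gweight.
have msq := measurable_sqr; have bsq := sqr_le_gweight.
have m1 : measurable_fun [set: gR] (fun s : R => - m * s) by exact: measurable_funM.
have m2 : measurable_fun [set: gR] (fun s : R => - q * s ^+ 2).
  exact: measurable_funM.
have b1 (s : R) : `|- m * s| <= `|m| * gweight s.
  by rewrite normrM normrN ler_wpM2l// norm_le_gweight.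
have b2 (s : R) : `|- q * s ^+ 2| <= (`|q| * 4) * gweight s.
  by rewrite normrM normrN -mulrA ler_wpM2l.
have b12 (s : R) : `|- m * s + - q * s ^+ 2| <= (`|m| + `|q| * 4) * gweight s.
  by rewrite (le_trans (ler_normD _ _))// mulrDl lerD.
have m12 : measurable_fun [set: gR] (fun s : R => - m * s + - q * s ^+ 2).
  exact: measurable_funD.
have b3 (s : R) : `|- lse z| <= `|lse z| * gweight s.
  by rewrite normrN ler_peMr// gweight_ge1.
have b123 (s : R) : `|- lse z + (- m * s + - q * s ^+ 2)| <=
    (`|lse z| + (`|m| + `|q| * 4)) * gweight s.
  by rewrite (le_trans (ler_normD _ _))// mulrDl lerD.
have m123 : measurable_fun [set: gR]
    (fun s : R => - lse z + (- m * s + - q * s ^+ 2)) by exact: measurable_funD.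
have -> : smooth a lse z - lse z - kappa / 2 * gvar a z = gexp r.
  rewrite /r (gexpD mf m123 bf b123) (@gexpD _ `|lse z| _ (fun=> - lse z) _ _ m12 _ b12)//.
  rewrite (gexpD m1 m2 b1 b2) (gexpZ _ mid bid) (gexpZ _ msq bsq) gexp_id gexp_cst.
  by rewrite /smooth /q; ring.
apply: norm_gexp_le; first exact: measurable_funD.
move=> s; have := lse_taylor v0 z a s.
have -> : lse (fun v => z v + s * a v) - lse z - s * gmean a z -
    s ^+ 2 * (gvar a z / 2) = r s by rewrite /r /q /m; ring.
move=> /le_trans; apply.
rewrite (_ : 48 * _ * _ = 6 * norm1 a ^+ 3 * (8 * gweight s)); last by ring.
by rewrite ler_wpM2l ?norm3_le_gweight// mulr_ge0// exprn_ge0// norm1_ge0.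
Qed.

Definition gvars l z : R := \sum_(a <- l) gvar a z.

Lemma sup_lipschitz_gvars l : exists L, sup_lipschitz L (gvars l).
Proof.
elim: l => [|a l [L lL]].
  exists 0; rewrite (_ : gvars [::] = fun=> 0); first exact: sup_lipschitz_cst.
  by apply/funext => z; rewrite /gvars big_nil.
exists (6 * norm1 a ^+ 2 + L).
rewrite (_ : gvars (a :: l) = fun z => gvar a z + gvars l z).
  by apply: sup_lipschitzD => //; exact: (sup_lipschitz_gvar v0).
by apply/funext => z; rewrite /gvars big_cons.
Qed.

(** Induction on the directions. The tail is replaced by its expansion [H] at cost [C e^3];
    smoothing [lse] along [e a] adds one second-order term up to [O(e^3)]; smoothing [gvars l] moves
    it by [O(e)] only, against the coefficient [c = O(e^2)]. Uniformity in [z] is what allows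
    iteration. *)
Lemma smooths_lse_taylor l : exists2 C, 0 <= C &
  forall (e : R) z, 0 <= e -> e <= 1 ->
  `|smooths [seq e \*o a | a <- l] lse z - lse z - e ^+ 2 * (kappa / 2) * gvars l z|
  <= C * e ^+ 3.
Proof.
have lL := sup_lipschitz_lse (R := R) v0.
elim: l => [|a l [C C0 IH]].
  exists 0 => // e z _ _; rewrite /gvars big_nil /= mulr0 subr0 subrr normr0.
  by rewrite mul0r.
have [L gL] := sup_lipschitz_gvars l; have [L0 _ _] := gL.
have N0 := norm1_ge0 a; have k0 := kappa_ge0; have s0 := sqrtr_ge0 (2 : R).
exists (C + 48 * norm1 a ^+ 3 * Num.sqrt 2 +
    kappa / 2 * (L * norm1 a * Num.sqrt 2)).
  by rewrite !addr_ge0// ?mulr_ge0// ?exprn_ge0.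
move=> e z e0 e1.
have e30 : 0 <= C * e ^+ 3 by rewrite mulr_ge0// exprn_ge0.
set c := e ^+ 2 * (kappa / 2) in IH *.
pose H z := lse z + c * gvars l z.
have HL := sup_lipschitzD lL (sup_lipschitzZ c gL).
set G := smooths [seq e \*o a | a <- l] lse.
have GL : sup_lipschitz 1 G by exact: sup_lipschitz_smooths.
have GH y : `|G y - H y| <= C * e ^+ 3 by rewrite /H opprD addrA; exact: IH.
have h1 : smooth (e \*o a) G z <= smooth (e \*o a) H z + C * e ^+ 3.
  rewrite -[leRHS](congr1 (fun F => F z) (smooth_addc (e \*o a) (C * e ^+ 3) HL)).
  apply: (le_smooth _ _ GL (sup_lipschitz_addc _ HL)) => y.
  by have := GH y; rewrite ler_norml => /andP[_]; rewrite lerBlDl.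
have h2 : smooth (e \*o a) H z - C * e ^+ 3 <= smooth (e \*o a) G z.
  rewrite -[leLHS](congr1 (fun F => F z) (smooth_addc (e \*o a) (- (C * e ^+ 3)) HL)).
  apply: (le_smooth _ _ (sup_lipschitz_addc _ HL) GL) => y.
  by have := GH y; rewrite ler_norml => /andP[+ _]; rewrite lerBrDr addrC.
have h3 : smooth (e \*o a) H z =
    smooth (e \*o a) lse z + c * smooth (e \*o a) (gvars l) z.
  exact: (smoothD (e \*o a) c z lL gL).
have h4 := smooth_lse_taylor (e \*o a) z.
have h5 := smooth_approx (e \*o a) z gL.
rewrite (gvarZ v0) in h4; rewrite norm1Z in h4; rewrite norm1Z in h5.
rewrite (ger0_norm e0) in h4; rewrite (ger0_norm e0) in h5.
have -> : gvars (a :: l) z = gvar a z + gvars l z by rewrite /gvars big_cons.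
rewrite /= -/G.
have c0 : 0 <= c by rewrite mulr_ge0 ?sqr_ge0// divr_ge0.
have {}h5 : `|c * (smooth (e \*o a) (gvars l) z - gvars l z)| <=
    kappa / 2 * (L * norm1 a * Num.sqrt 2) * e ^+ 3.
  rewrite normrM ger0_norm//.
  have := ler_wpM2l c0 h5; move=> /le_trans; apply.
  by rewrite /c le_eqVlt; apply/orP; left; apply/eqP; ring.
have {}h4 : `|smooth (e \*o a) lse z - lse z - c * gvar a z| <=
    48 * norm1 a ^+ 3 * Num.sqrt 2 * e ^+ 3.
  rewrite (_ : c * gvar a z = kappa / 2 * (e ^+ 2 * gvar a z)); last first.
    by rewrite /c; ring.
  rewrite (le_trans h4)// exprMn le_eqVlt; apply/orP; left; apply/eqP; ring.
rewrite h3 in h1 h2.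
have -> : smooth (e \*o a) G z - lse z - c * (gvar a z + gvars l z) =
  (smooth (e \*o a) G z - smooth (e \*o a) lse z - c * smooth (e \*o a) (gvars l) z)
  + (smooth (e \*o a) lse z - lse z - c * gvar a z)
  + c * (smooth (e \*o a) (gvars l) z - gvars l z) by ring.
rewrite (le_trans (ler_normD _ _))// 2!mulrDl lerD// (le_trans (ler_normD _ _))//.
by rewrite lerD// ler_norml; apply/andP; split; lra.
Qed.

(** In the pair form of [gvar] the weights are nonnegative and independent of the direction, so the
    sums over directions are compared pair by pair. *)
Lemma le_gvars l l' z :
  (forall v w, \sum_(a <- l) (a v - a w) ^+ 2 <= \sum_(a <- l') (a v - a w) ^+ 2) ->
  gvars l z <= gvars l' z.
Proof.
move=> ll'.
have E (k : seq (V -> R)) : gvars k z = 2^-1 * \sum_v \sum_w gibbs z v * gibbs z w *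
    \sum_(a <- k) (a v - a w) ^+ 2.
  rewrite /gvars; under eq_bigr do rewrite (gvarE v0).
  rewrite -mulr_sumr exchange_big; congr (_ * _); apply: eq_bigr => v _.
  by rewrite exchange_big; apply: eq_bigr => w _; rewrite mulr_sumr.
rewrite !E ler_wpM2l// ; apply: ler_sum => v _; apply: ler_sum => w _.
by rewrite ler_wpM2l// mulr_ge0// gibbs_ge0.
Qed.

(* Splitting each Gaussian vector into [n] independent copies of variance [1/n]
   and exchanging them one at a time costs [O (n^(-3/2))] per copy. *)
Theorem sudakov_fernique_lse l l' z :
  (forall v w, \sum_(a <- l) (a v - a w) ^+ 2 <= \sum_(a <- l') (a v - a w) ^+ 2) ->
  smooths l lse z <= smooths l' lse z.
Proof.
move=> ll'.
have lL := sup_lipschitz_lse (R := R) v0.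
have [C C0 HC] := smooths_lse_taylor l.
have [C' C'0 HC'] := smooths_lse_taylor l'.
have step n : smooths l lse z <= smooths l' lse z + (C + C') / Num.sqrt n.+1%:R.
  set e := (Num.sqrt n.+1%:R)^-1.
  have e0 : 0 <= e by rewrite invr_ge0 sqrtr_ge0.
  have n0 : Num.sqrt n.+1%:R != 0 :> R by rewrite gt_eqF// sqrtr_gt0.
  have e1 : e <= 1.
    rewrite invf_le1 ?sqrtr_gt0// -[leLHS]sqrtr1 ler_wsqrtr//.
    by rewrite ler1n.
  set A := [seq e \*o a | a <- l]; set B := [seq e \*o a | a <- l'].
  pose d := (C + C') * e ^+ 3.
  have AB y : smooths A lse y <= smooths B lse y + d.
    have := HC e y e0 e1; have := HC' e y e0 e1; have := le_gvars y ll'.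
    have := kappa_ge0; rewrite -/A -/B !ler_norml => k0 h /andP[h1 h2] /andP[h3 h4].
    have : e ^+ 2 * (kappa / 2) * gvars l y <= e ^+ 2 * (kappa / 2) * gvars l' y.
      by rewrite ler_wpM2l// mulr_ge0 ?sqr_ge0// divr_ge0.
    by rewrite /d mulrDl; lra.
  have BL := sup_lipschitz_smooths B lL; have AL := sup_lipschitz_smooths A lL.
  (* Exchange in the manner of Lindeberg: one round of [A] becomes a round of [B] at cost [d]; this
     [B] is moved outside the remaining [k] rounds of [A], to which the induction hypothesis
     applies. *)
  have key k y : iter k (smooths A) lse y <= iter k (smooths B) lse y + k%:R * d.
    elim: k y => [|k IH] y; first by rewrite mul0r addr0.
    have AkL g L : sup_lipschitz L g -> sup_lipschitz L (iter k (smooths A) g).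
      exact: sup_lipschitz_iter_smooths.
    have BkL := sup_lipschitz_iter_smooths B k lL.
    have mono g g' L L' x : sup_lipschitz L g -> sup_lipschitz L' g' ->
        (forall x, g x <= g' x) ->
        iter k (smooths A) g x <= iter k (smooths A) g' x.
      move=> gL gL' gg'; elim: k x {IH AkL BkL} => // m IHm x; rewrite !iterS.
      exact: (le_smooths A x (sup_lipschitz_iter_smooths A m gL)
        (sup_lipschitz_iter_smooths A m gL') IHm).
    have addc g L (c : R) : sup_lipschitz L g ->
        iter k (smooths A) (fun x => g x + c) = (fun x => iter k (smooths A) g x + c).
      move=> gL; elim: k {IH AkL BkL mono} => // m IHm; rewrite !iterS IHm.
      by rewrite (smooths_addc _ _ (sup_lipschitz_iter_smooths A m gL)).
    rewrite iterSr (le_trans (mono _ _ _ _ _ AL (sup_lipschitz_addc d BL) AB))//.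
    rewrite (addc _ _ _ BL) (iter_smooths_comm _ _ _ lL) mulrSr mulrDl mul1r addrA lerD2r.
    rewrite iterS.
    have := le_smooths B y (AkL _ _ lL) (sup_lipschitz_addc (k%:R * d) BkL) IH.
    by rewrite (smooths_addc _ _ BkL).
  (* All rounds at scale [e] recompose the original smoothing, as [sqrt n.+1 * e = 1]. *)
  have E (k : seq (V -> R)) : iter n.+1 (smooths [seq e \*o a | a <- k]) lse = smooths k lse.
    rewrite (iter_smooths _ _ lL); congr (smooths _ lse).
    rewrite -map_comp -[RHS]map_id; apply: eq_map => a; apply/funext => v /=.
    by rewrite mulrA divff// mul1r.
  (* The accumulated error is [C + C'] times [n.+1 * e^3 = 1 / sqrt n.+1]. *)
  have := key n.+1 z; rewrite !E => /le_trans; apply; rewrite lerD2l /d.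
  rewrite mulrCA ler_wpM2l ?addr_ge0// /e.
  rewrite -{1}(@sqr_sqrtr _ n.+1%:R)// le_eqVlt; apply/orP; left; apply/eqP.
  by field.
rewrite leNgt; apply/negP => lt_ll'.
set D := smooths l lse z - smooths l' lse z.
have D0 : 0 < D by rewrite subr_gt0.
(* A positive gap [D] would satisfy [D <= (C + C') / sqrt n.+1] for every [n], which fails once
   [n.+1 > K^2]. *)
pose K := (C + C') / D.
have [n Kn] : exists n, K ^+ 2 < n.+1%:R.
  exists (Num.bound (K ^+ 2)); apply: lt_trans (archi_boundP (sqr_ge0 K)) _.
  by rewrite ltr_nat.
have K0 : 0 <= K by apply: divr_ge0; [exact: addr_ge0|exact: ltW].
have sn0 : 0 < Num.sqrt n.+1%:R :> R by rewrite sqrtr_gt0.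
have : K < Num.sqrt n.+1%:R.
  by rewrite -[ltLHS]ger0_norm// -sqrtr_sqr ltr_sqrt.
rewrite ltNge => /negP; apply.
have := step n; rewrite -lerBlDl -/D => h.
by rewrite /K ler_pdivlMr// mulrC -ler_pdivlMr.
Qed.

End comparison.

(** * Laws of Gaussian sums *)

Section independent_integral.
Context d (T : measurableType d) {R : realType} (P : probability T R).
Local Notation gR := (measurableTypeR R).
Local Notation gamma := (@normal_prob R 0 1).
Variables (X : T -> gR) (G : set (set T)).
Hypothesis mX : measurable_fun setT X.
Hypothesis lawX : forall A, measurable A -> P (X @^-1` A) = gamma A.
Hypothesis Gm : G `<=` measurable.
Hypothesis GI : setI_closed G.
Hypothesis GT : G setT.
Hypothesis indep : forall A B, measurable A -> G B ->
  P (X @^-1` A `&` B) = (P (X @^-1` A) * P B)%E.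
Local Notation T' := (g_sigma_algebraType G).

Let mpreX A : measurable A -> measurable (X @^-1` A).
Proof. by move=> mA; rewrite -[X in measurable X]setTI; exact: mX. Qed.

(** For fixed [A] both sides are finite measures in [B] that agree on the pi-system [G]. *)
Lemma independent_g_sigma_algebra A B : measurable A -> <<s G >> B ->
  P (X @^-1` A `&` B) = (P (X @^-1` A) * P B)%E.
Proof.
move=> mA sGB.
have c0 : 0 <= fine (P (X @^-1` A)) by exact: fine_ge0.
have PA : (fine (P (X @^-1` A)))%:E = P (X @^-1` A).
  by rewrite fineK// fin_num_measure//; exact: mpreX.
pose m1 : {measure set T -> \bar R} := mrestr P (mpreX mA).
pose m2 : {measure set T -> \bar R} := mscale (NngNum c0) P.
rewrite setIC -[LHS]/(m1 B).
have -> : (P (X @^-1` A) * P B)%E = m2 B by rewrite /m2/= /mscale/= PA.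
apply: (g_sigma_algebra_measure_unique G Gm (fun=> setT)) => //.
- by rewrite bigcup_const//; exists 0%N.
- move=> C GC; rewrite /m1/m2/= /mrestr /mscale/= PA setIC.
  exact: indep.
- move=> _; rewrite /m1/= /mrestr setTI.
  by rewrite (le_lt_trans (probability_le1 _ _)) ?ltry//; exact: mpreX.
Qed.

Lemma measurable_id_g_sigma_algebra : measurable_fun setT (id : T -> T').
Proof.
move=> _ B mB; rewrite setTI preimage_id.
by move: B mB; apply: smallest_sub => //; exact: sigma_algebra_measurable.
Qed.

(** The second argument is the sample point itself, measured by the coarser sigma-algebra generated
    by [G]. The law of [w |-> (X w, w)] on [gR * T'] is then a product, and Fubini applies without
    forming a vector of the remaining variables. *)
Lemma integral_independent (k : gR * T' -> R) : measurable_fun setT k ->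
  P.-integrable setT (fun w => (k (X w, w))%:E) ->
  (\int[P]_w (k (X w, w))%:E = \int[gamma]_s \int[P]_w (k (s, w))%:E)%E.
Proof.
move=> mk ik.
have mid := measurable_id_g_sigma_algebra.
pose idT : {mfun T >-> T'} := HB.pack (id : T -> T') (isMeasurableFun.Build _ _ _ _ _ mid).
pose mu' : probability T' R := distribution P idT.
pose pX (w : T) : gR * T' := (X w, w).
have mpX : measurable_fun setT pX by exact: measurable_fun_pair.
pose pXm : {mfun T >-> (gR * T')%type} := HB.pack pX (isMeasurableFun.Build _ _ _ _ _ mpX).
have eqm A : measurable A -> (gamma \x mu')%E A = distribution P pXm A.
  apply: product_measure_unique => B C mB mC.
  rewrite /= /distribution /pushforward/= preimage_id -lawX//.
  by rewrite -independent_g_sigma_algebra.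
have mEk : measurable_fun setT (EFin \o k) by exact/measurable_EFinP.
have ik' : (gamma \x mu')%E.-integrable setT (EFin \o k).
  apply/integrableP; split => //.
  rewrite (eq_measure_integral (distribution P pXm)); last by move=> A mA _; exact: eqm.
  rewrite ge0_integral_distribution//; last exact: measurableT_comp.
  by case/integrableP : ik.
transitivity (\int[gamma \x mu']_x (EFin \o k) x)%E.
  rewrite [RHS](eq_measure_integral (distribution P pXm)); last first.
    by move=> A mA _; exact: eqm.
  by rewrite integral_distribution.
rewrite -(integral12_prod_meas1 ik'); apply: eq_integral => s _.
have mks : measurable_fun [set: T'] (fun w => (k (s, w))%:E).
  by apply/measurable_EFinP; exact: measurableT_comp.
rewrite /fubini_F [LHS]integralE [RHS]integralE; congr (_ - _)%E.
  rewrite ge0_integral_distribution//.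
  exact: measurable_funepos.
rewrite ge0_integral_distribution//.
exact: measurable_funeneg.
Qed.

End independent_integral.

(** * Sums with independent standard Gaussian coefficients *)

Section gaussian_family.
Context d (T : measurableType d) {R : realType} (P : probability T R).
Context (I : choiceType) (D : set I) (Z : I -> {RV P >-> R}).
Hypothesis Zindep : mutually_independent D Z.
Hypothesis Zgauss : forall i, D i -> std_gaussian (Z i).
Local Notation gR := (measurableTypeR R).
Local Notation gamma := (@normal_prob R 0 1).

Let mZ i : measurable_fun setT (Z i : T -> gR).
Proof. exact: (@measurable_funPT _ _ _ _ (Z i)). Qed.

Lemma integral_std_gaussian i (f : gR -> \bar R) : D i ->
  measurable_fun setT f -> (forall s, 0 <= f s)%E ->
  (\int[P]_w f (Z i w) = \int[gamma]_s f s)%E.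
Proof.
move=> Di mf f0; 
  pose Zi : {mfun T >-> gR} := HB.pack (Z i : T -> gR)
    (isMeasurableFun.Build _ _ _ _ _ (@mZ i)).
rewrite -[LHS](ge0_integral_distribution Zi mf f0).
by apply: eq_measure_integral => A mA _; exact: Zgauss.
Qed.

Lemma integrable_std_gaussian i : D i ->
  P.-integrable setT (fun w => (`|Z i w|)%:E).
Proof.
move=> Di; apply/integrableP; split.
  by apply/measurable_EFinP; exact: measurableT_comp.
have mabs : measurable_fun [set: gR] (fun s : gR => (`|s|)%:E).
  by apply/measurable_EFinP; exact: normr_measurable.
have /integrableP[_] : gamma.-integrable setT (EFin \o (fun s : gR => `|s|)).
  apply: (@gaussian_integrable _ 1); first exact: normr_measurable.
  by move=> s; rewrite normr_id mul1r norm_le_gweight.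
apply: le_lt_trans; rewrite le_eqVlt; apply/orP; left; apply/eqP.
transitivity (\int[gamma]_s (`|s|)%:E)%E; last first.
  by apply: eq_integral => s _ /=; rewrite normr_id.
rewrite -(integral_std_gaussian Di mabs)//.
by apply: eq_integral => w _ /=; rewrite normr_id.
Qed.

Context {V : finType}.
Variables (L : R) (f : (V -> R) -> R) (x : I -> V -> R).
Hypothesis fL : sup_lipschitz L f.

Lemma integrable_gaussian_sum (l : seq I) z : (forall i, i \in l -> D i) ->
  P.-integrable setT (fun w => (f (fun v => z v + \sum_(i <- l) Z i w * x i v))%:E).
Proof.
move=> lD; have [L0 lip mf] := fL.
pose bnd (w : T) := `|f z| + \sum_(i <- l) (L * norm1 (x i)) * `|Z i w|.
have ibnd : P.-integrable setT (EFin \o bnd).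
  apply: (eq_integrable measurableT (fun w => (`|f z|)%:E +
    \sum_(i <- l) ((L * norm1 (x i))%:E * (`|Z i w|)%:E))%E).
    by move=> w _; rewrite /bnd/= EFinD -sumEFin.
  apply: integrableD => //; first exact: finite_measure_integrable_cst.
  elim: l lD {bnd} => [|i l IH] lD.
    by under eq_fun do rewrite big_nil; exact: integrable0.
  under eq_fun do rewrite big_cons; apply: integrableD => //.
    apply: integrableZl => //; apply: integrable_std_gaussian.
    by apply: lD; rewrite mem_head.
  by apply: IH => j jl; apply: lD; rewrite in_cons jl orbT.
apply: (le_integrable measurableT _ _ ibnd).
  apply/measurable_EFinP; apply: mf => v; apply: measurable_funD => //.
  by apply: measurable_sum => i; exact: measurable_funM.
move=> w _ /=; rewrite lee_fin [leRHS]ger0_norm; last first.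
  rewrite addr_ge0// sumr_ge0// => i _; rewrite !mulr_ge0//; exact: norm1_ge0.
rewrite -lerBlDl (le_trans (lerB_dist _ _))//.
under eq_bigr do rewrite -mulrA.
rewrite -mulr_sumr; apply: lip.
  by rewrite sumr_ge0// => i _; rewrite mulr_ge0// norm1_ge0.
move=> v; rewrite addrC addKr (le_trans (ler_norm_sum _ _ _))//.
by apply: ler_sum => i _; rewrite normrM mulrC ler_wpM2r// le_norm1.
Qed.

(** A pi-system generating the sigma-algebra of the [Z i] with [i] in [l]. The family [A] is indexed
    by all of [I], so that intersections are taken index by index. *)
Let cylinder (l : seq I) : set (set T) := [set B | exists2 A : I -> set R,
  (forall i, measurable (A i)) & B = \bigcap_(i in [set` l]) (Z i @^-1` A i)].

Let measurable_preZ i (A : set R) : measurable A -> measurable (Z i @^-1` A).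
Proof. by move=> mA; rewrite -[X in measurable X]setTI; exact: measurable_funPT. Qed.

Let cylinder_measurable l : cylinder l `<=` measurable.
Proof.
move=> _ [A mA ->]; apply: fin_bigcap_measurable; first exact: finite_seq.
by move=> i _; exact: measurable_preZ.
Qed.

Let cylinderI l : setI_closed (cylinder l).
Proof.
move=> _ _ [A mA ->] [B mB ->]; exists (fun i => A i `&` B i).
  by move=> i; exact: measurableI.
by rewrite -bigcapI.
Qed.

Let cylinderT l : cylinder l setT.
Proof.
exists (fun=> setT) => //; apply/esym/seteqP; split => // w _ i _ //.
Qed.

Let cylinder_indep e l (A B : set _) : uniq (e :: l) ->
  (forall i, i \in e :: l -> D i) -> measurable A -> cylinder l B ->
  P (Z e @^-1` A `&` B) = (P (Z e @^-1` A) * P B)%E.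
Proof.
move=> /= /andP[el ul] lD mA [C mC ->].
have prodE (s : seq I) (F : I -> set R) : uniq s -> (forall i, i \in s -> D i) ->
    (forall i, measurable (F i)) ->
    P (\bigcap_(i in [set` s]) (Z i @^-1` F i)) = (\prod_(i <- s) P (Z i @^-1` F i))%E.
  move=> us sD mF.
  have := @Zindep [fset i in s]%fset F.
  rewrite (_ : [set` [fset i in s]%fset] = [set` s]); last first.
    by apply/seteqP; split => i /=; rewrite !inE.
  move=> -> //; apply: perm_big; apply: uniq_perm => // i; by rewrite !inE.
(* Putting [A] at [e] makes the event a cylinder over [e :: l]; the product formula is then used
   over [e :: l] and over [l]. *)
pose F i := if i == e then A else C i.
have mF i : measurable (F i) by rewrite /F; case: ifP.
have FC i : i \in l -> F i = C i.
  by move=> il; rewrite /F; case: eqP => // ie; rewrite -ie il in el.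
have := prodE (e :: l) F; rewrite /= el ul => /(_ isT lD mF).
rewrite big_cons {2}/F eqxx.
rewrite (_ : \bigcap_(i in _) _ = Z e @^-1` A `&`
    \bigcap_(i in [set` l]) (Z i @^-1` C i)); last first.
  apply/seteqP; split => w /=.
    move=> h; split; first by have := h e; rewrite /= mem_head /F eqxx; exact.
    by move=> i /= il; rewrite -(FC _ il); apply: h; rewrite /= in_cons il orbT.
  move=> [h1 h2] i; rewrite /= in_cons /F => /orP[/eqP ->|il]; first by rewrite eqxx.
  by case: eqP => [->//|_]; exact: h2.
move=> ->; rewrite prodE//; last by move=> i il; apply: lD; rewrite in_cons il orbT.
by congr (_ * _)%E; apply: eq_big_seq => i il; rewrite FC.
Qed.

Let measurable_cylinder i l : i \in l ->
  measurable_fun [set: g_sigma_algebraType (cylinder l)] (Z i : _ -> R).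
Proof.
move=> il _ A mA; rewrite setTI; apply: sub_sigma_algebra.
exists (fun j => if j == i then A else setT).
  by move=> j; case: ifP.
apply/seteqP; split => w /=.
  by move=> ZA j _ /=; case: eqP => [->|].
by move=> /(_ i il); rewrite eqxx.
Qed.

(** Variables are split off one at a time. With [Z e] frozen at [s], its contribution joins the base
    point, and the induction hypothesis applies at [z + s * x e]. *)
Theorem integral_gaussian_sum (l : seq I) z : uniq l -> (forall i, i \in l -> D i) ->
  (\int[P]_w (f (fun v => z v + \sum_(i <- l) Z i w * x i v))%:E =
   (smooths (map x l) f z)%:E)%E.
Proof.
elim: l z => [|e l IH] z ul lD.
  under eq_integral.
    move=> w _; rewrite (_ : (fun v => _) = z); first over.
    by apply/funext => v; rewrite big_nil addr0.
  by rewrite integral_cst//= probability_setT mule1.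
have De : D e by apply: lD; rewrite mem_head.
have lD' i : i \in l -> D i by move=> il; apply: lD; rewrite in_cons il orbT.
pose k (y : gR * g_sigma_algebraType (cylinder l)) : R :=
  f (fun v => (z v + y.1 * x e v) + \sum_(i <- l) Z i y.2 * x i v).
have mk : measurable_fun setT k.
  have [_ _ mf] := fL.
  apply: (mf _ _ (fun v (y : gR * g_sigma_algebraType (cylinder l)) =>
    (z v + y.1 * x e v) + \sum_(i <- l) Z i y.2 * x i v)) => v.
  apply: measurable_funD.
    by apply: measurable_funD => //; exact: measurable_funM.
  (* The test [i \in l] limits the claim to the variables that are measurable for the coarser
     sigma-algebra. *)
  rewrite (_ : (fun _ => _) = (fun y : gR * g_sigma_algebraType (cylinder l) =>
      \sum_(i <- l) (if i \in l then Z i y.2 * x i v else 0))); last first.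
    by apply/funext => y; rewrite big_seq [RHS]big_seq; apply: eq_bigr => i ->.
  apply: measurable_sum => i; case: (boolP (i \in l)) => // il.
  apply: measurable_funM => //.
  exact: (measurableT_comp (measurable_cylinder il)).
have kE w : k (Z e w, w) = f (fun v => z v + \sum_(i <- e :: l) Z i w * x i v).
  by rewrite /k/=; congr f; apply/funext => v; rewrite big_cons addrA.
have ik := integrable_gaussian_sum z lD.
under eq_integral do rewrite -kE.
have lawZ (A : set gR) : measurable A -> P (Z e @^-1` A) = gamma A.
  exact: (Zgauss De).
have ind (A : set gR) B : measurable A -> cylinder l B ->
    P (Z e @^-1` A `&` B) = (P (Z e @^-1` A) * P B)%E.
  by move=> mA; exact: cylinder_indep.
have ik' : P.-integrable setT (fun w => (k (Z e w, w))%:E).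
  by under eq_fun do rewrite kE.
rewrite (integral_independent (@mZ e) lawZ (@cylinder_measurable l)
  (@cylinderI l) (cylinderT l) ind mk ik').
under eq_integral.
  move=> s _; rewrite /k/=.
  rewrite (IH (fun v => z v + s * x e v))//; last by move: ul => /andP[].
  over.
rewrite /= /smooth /gexp /Rintegral fineK//.
have gL := sup_lipschitz_smooths (map x l) fL.
apply: integrable_fin_num => //.
exact: (gaussian_integrable (measurable_smooth_line gL z (x e)) (smooth_bound gL z (x e))).
Qed.

End gaussian_family.

(** * Increments of the two processes *)

Section bilinear_forms.
Context {R : realType} {d : nat}.
Implicit Types (x y z : 'I_d -> R) (B : 'I_d -> 'I_d -> R).

Definition sqnorm x : R := \sum_i x i ^+ 2.
Definition bform B x y : R := \sum_i \sum_j x i * B i j * y j.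

Lemma sqnorm_ge0 x : 0 <= sqnorm x.
Proof. by apply: sumr_ge0 => i _; exact: sqr_ge0. Qed.

(** Lagrange's identity: twice the defect is the double sum of [(x_i y_j - x_j y_i)^2]. *)
Lemma cauchy_schwarz_sqr x y : (\sum_i x i * y i) ^+ 2 <= sqnorm x * sqnorm y.
Proof.
have E f g : (\sum_i f i) * (\sum_j g j) = \sum_i \sum_j f i * g j :> R.
  by rewrite mulr_suml; apply: eq_bigr => i _; rewrite mulr_sumr.
have : 0 <= \sum_(i < d) \sum_(j < d) (x i * y j - x j * y i) ^+ 2.
  by apply: sumr_ge0 => i _; apply: sumr_ge0 => j _; exact: sqr_ge0.
have -> : \sum_(i < d) \sum_(j < d) (x i * y j - x j * y i) ^+ 2 =
    sqnorm x * sqnorm y + sqnorm y * sqnorm x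
    - 2 * (\sum_i x i * y i) ^+ 2.
  rewrite expr2 !E mulr_sumr -big_split -sumrB; apply: eq_bigr => i _.
  rewrite mulr_sumr -big_split -sumrB; apply: eq_bigr => j _ /=; ring.
by move=> h; lra.
Qed.

Lemma cauchy_schwarz x y :
  \sum_i x i * y i <= Num.sqrt (sqnorm x) * Num.sqrt (sqnorm y).
Proof.
rewrite (le_trans (ler_norm _))// -sqrtr_sqr -sqrtrM ?sqnorm_ge0//.
by rewrite ler_wsqrtr// cauchy_schwarz_sqr.
Qed.

Lemma bformDl B x y z :
  bform B (fun i => x i + y i) z = bform B x z + bform B y z.
Proof.
rewrite /bform -big_split; apply: eq_bigr => i _; rewrite -big_split.
by apply: eq_bigr => j _ /=; ring.
Qed.

Lemma bformDr B x y z :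
  bform B z (fun i => x i + y i) = bform B z x + bform B z y.
Proof.
rewrite /bform -big_split; apply: eq_bigr => i _; rewrite -big_split.
by apply: eq_bigr => j _ /=; ring.
Qed.

Lemma bformZl B (c : R) x z : bform B (fun i => c * x i) z = c * bform B x z.
Proof.
rewrite /bform mulr_sumr; apply: eq_bigr => i _; rewrite mulr_sumr.
by apply: eq_bigr => j _; rewrite !mulrA.
Qed.

Lemma bformZr B (c : R) x z : bform B z (fun i => c * x i) = c * bform B z x.
Proof.
rewrite /bform mulr_sumr; apply: eq_bigr => i _; rewrite mulr_sumr.
by apply: eq_bigr => j _ /=; ring.
Qed.

Lemma bformBl B x y z :
  bform B (fun i => x i - y i) z = bform B x z - bform B y z.
Proof.
rewrite -[X in _ - X]mul1r -mulNr -bformZl -bformDl; congr (bform B _ z).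
by apply/funext => i; rewrite mulN1r.
Qed.

Lemma bformBr B x y z :
  bform B z (fun i => x i - y i) = bform B z x - bform B z y.
Proof.
rewrite -[X in _ - X]mul1r -mulNr -bformZr -bformDr; congr (bform B z _).
by apply/funext => i; rewrite mulN1r.
Qed.

Lemma bformC B x y : (forall i j, B i j = B j i) -> bform B x y = bform B y x.
Proof.
move=> BC; rewrite /bform exchange_big; apply: eq_bigr => i _.
by apply: eq_bigr => j _; rewrite BC; ring.
Qed.

Lemma bform_ge0 B x y : (forall i j, 0 <= B i j) -> (forall i, 0 <= x i) ->
  (forall i, 0 <= y i) -> 0 <= bform B x y.
Proof.
by move=> B0 x0 y0; apply: sumr_ge0 => i _; apply: sumr_ge0 => j _; rewrite !mulr_ge0.
Qed.

Lemma bformE B x y : bform B x y = \sum_i x i * \sum_j B i j * y j.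
Proof.
by apply: eq_bigr => i _; rewrite mulr_sumr; apply: eq_bigr => j _; rewrite mulrA.
Qed.

End bilinear_forms.

Section increment_comparison.
Context {R : realType} {d : nat}.
Variable b : 'I_d -> 'I_d -> R.
Hypothesis b_ge0 : forall i j, 0 <= b i j.
Hypothesis b_sym : forall i j, b i j = b j i.
Local Notation B := (fun i j => b i j ^+ 2).
Implicit Types v w : 'I_d -> R.

Definition rownorm v i : R := Num.sqrt (\sum_j b i j ^+ 2 * v j ^+ 2).

Lemma sqr_rownorm v i : rownorm v i ^+ 2 = \sum_j b i j ^+ 2 * v j ^+ 2.
Proof.
by rewrite sqr_sqrtr// sumr_ge0// => j _; rewrite mulr_ge0// sqr_ge0.
Qed.

(** From [2 a b <= a^2 + b^2]. This bound serves on the positive part of [v i * w i]; the lower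
    bound that follows, by Cauchy-Schwarz, serves on the negative part. *)
Lemma rownormM_le v w i : rownorm v i * rownorm w i <=
  \sum_j b i j ^+ 2 * ((v j ^+ 2 + w j ^+ 2) / 2).
Proof.
have -> : \sum_j b i j ^+ 2 * ((v j ^+ 2 + w j ^+ 2) / 2) =
    (rownorm v i ^+ 2 + rownorm w i ^+ 2) / 2.
  rewrite !sqr_rownorm -big_split mulr_suml.
  by apply: eq_bigr => j _ /=; ring.
by have := sqr_ge0 (rownorm v i - rownorm w i); lra.
Qed.

Lemma rownormM_ge v w i :
  \sum_j b i j ^+ 2 * `|v j * w j| <= rownorm v i * rownorm w i.
Proof.
have := cauchy_schwarz (fun j => b i j * `|v j|) (fun j => b i j * `|w j|).
have E (x : 'I_d -> R) :
    Num.sqrt (sqnorm (fun j => b i j * `|x j|)) = rownorm x i.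
  congr Num.sqrt; apply: eq_bigr => j _.
  by rewrite exprMn real_normK ?num_real.
rewrite !E; apply: le_trans; rewrite le_eqVlt; apply/orP; left; apply/eqP.
by apply: eq_bigr => j _; rewrite normrM; ring.
Qed.

(* With [s = (v^2 + w^2) / 2] and [u = v w] entrywise, the difference of the two
   sides is at least
   [(s - u^+)' B (s - u^+) + 3 (u^-)' B u^-], and [s >= u^+ >= 0 <= u^-]. *)
Lemma sum_rownormM_le v w :
  2 * \sum_i v i * w i * (rownorm v i * rownorm w i) <=
  bform B (fun i => (v i ^+ 2 + w i ^+ 2) / 2) (fun i => (v i ^+ 2 + w i ^+ 2) / 2)
  + bform B (fun i => v i * w i) (fun i => v i * w i).
Proof.
pose s i := (v i ^+ 2 + w i ^+ 2) / 2; pose u i := v i * w i.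
suff : 2 * \sum_i u i * (rownorm v i * rownorm w i) <= bform B s s + bform B u u by [].
have BC i j : B i j = B j i by rewrite /= b_sym.
have B0 i j : 0 <= B i j by exact: sqr_ge0.
pose up i := (`|u i| + u i) / 2; pose un i := (`|u i| - u i) / 2.
have up0 i : 0 <= up i.
  by rewrite /up divr_ge0// -lerBlDr sub0r -normrN ler_norm.
have un0 i : 0 <= un i by rewrite /un divr_ge0// subr_ge0 ler_norm.
have uE : u = fun i => up i - un i by apply/funext => i; rewrite /up /un; lra.
have auE i : `|u i| = up i + un i by rewrite /up /un; lra.
have su i : 0 <= s i - up i.
  have : `|u i| <= s i.
    rewrite /u normrM /s -(real_normK (num_real (v i))) -(real_normK (num_real (w i))).
    by have := sqr_ge0 (`|v i| - `|w i|); lra.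
  by have := un0 i; rewrite auE; lra.
(* [up] takes the upper bound for the product of row norms and [un] the lower one, where
   [|u| = up + un]. *)
have h : \sum_i u i * (rownorm v i * rownorm w i) <=
    bform B up s - bform B un (fun i => up i + un i).
  rewrite !bformE -sumrB; apply: ler_sum => i _.
  rewrite {1}uE mulrBl lerB// ler_wpM2l//; first exact: rownormM_le.
  under eq_bigr do rewrite -auE.
  exact: rownormM_ge.
have h1 := bform_ge0 B0 su su.
have h2 := bform_ge0 B0 un0 un0.
move: h h1; rewrite uE !bformBl !bformBr !bformDr.
rewrite (bformC s up BC) (bformC un up BC).
by lra.
Qed.

Hypothesis B_psd : forall x, 0 <= bform B x x.

(** Let [p = v^2], [q = w^2] and [u = v w] entrywise. The factor 2 on the row terms makes the
    contributions of [u' B u] cancel exactly after [sum_rownormM_le], and the difference of the two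
    sides is at least [(p - q)' B (p - q)]. *)
Lemma increment_comparison v w :
  2 * \sum_i \sum_j b i j ^+ 2 * (v i * v j - w i * w j) ^+ 2 <=
  \sum_i (2 * (v i * rownorm v i) - 2 * (w i * rownorm w i)) ^+ 2.
Proof.
have BC i j : B i j = B j i by rewrite /= b_sym.
pose p i := v i ^+ 2; pose q i := w i ^+ 2; pose u i := v i * w i.
have -> : \sum_i \sum_j b i j ^+ 2 * (v i * v j - w i * w j) ^+ 2 =
    bform B p p + bform B q q - 2 * bform B u u.
  rewrite /bform mulr_sumr -big_split -sumrB; apply: eq_bigr => i _.
  rewrite mulr_sumr -big_split -sumrB; apply: eq_bigr => j _.
  by rewrite /p /q /u /=; ring.
have -> : \sum_i (2 * (v i * rownorm v i) - 2 * (w i * rownorm w i)) ^+ 2 =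
    4 * (bform B p p + bform B q q
      - 2 * \sum_i u i * (rownorm v i * rownorm w i)).
  rewrite !bformE mulr_sumr -big_split -sumrB mulr_sumr; apply: eq_bigr => i _.
  by rewrite /p /q /u /= -!sqr_rownorm; ring.
have := sum_rownormM_le v w.
have -> : (fun i => (v i ^+ 2 + w i ^+ 2) / 2) = (fun i => 2^-1 * (p i + q i)).
  by apply/funext => i; rewrite mulrC.
rewrite bformZl bformZr !bformDl !bformDr -/u.
have := B_psd (fun i => p i - q i); rewrite !bformBl !bformBr.
rewrite (bformC q p BC).
move: (\sum_i _) (bform _ p p) (bform _ q q) (bform _ u u) (bform _ p q).
by move=> *; lra.
Qed.

(** The case of opposite signs. By [(x + y)^2 <= 2 x^2 + 2 y^2], and since each double sum is at
    most [beta^2] on the unit ball, the constant is [2 * 2 * 2]. *)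
Lemma increment_comparison_flip (beta : R) v w : sqnorm v <= 1 -> sqnorm w <= 1 ->
  (forall i j, b i j <= beta) ->
  2 * \sum_i \sum_j b i j ^+ 2 * (v i * v j + w i * w j) ^+ 2 <= 8 * beta ^+ 2.
Proof.
move=> v1 w1 bb.
have sq (x : 'I_d -> R) : sqnorm x <= 1 ->
    \sum_i \sum_j beta ^+ 2 * (x i * x j) ^+ 2 <= beta ^+ 2.
  move=> x1; under eq_bigr do rewrite -mulr_sumr.
  rewrite -mulr_sumr ler_piMr ?sqr_ge0//.
  have -> : \sum_i \sum_j (x i * x j) ^+ 2 = sqnorm x * sqnorm x.
    rewrite mulr_suml; apply: eq_bigr => i _; rewrite mulr_sumr.
    by apply: eq_bigr => j _; rewrite exprMn.
  by rewrite mulr_ile1// sqnorm_ge0.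
have : \sum_i \sum_j b i j ^+ 2 * (v i * v j + w i * w j) ^+ 2 <=
    2 * (\sum_i \sum_j beta ^+ 2 * (v i * v j) ^+ 2 +
         \sum_i \sum_j beta ^+ 2 * (w i * w j) ^+ 2).
  rewrite -big_split mulr_sumr; apply: ler_sum => i _.
  rewrite -big_split mulr_sumr; apply: ler_sum => j _ /=.
  have bb2 : b i j ^+ 2 <= beta ^+ 2.
    by rewrite lerXn2r// nnegrE ?b_ge0// (le_trans (b_ge0 i j)).
  apply: (@le_trans _ _ (beta ^+ 2 * (v i * v j + w i * w j) ^+ 2)).
    by rewrite ler_wpM2r// sqr_ge0.
  rewrite (_ : 2 * _ = beta ^+ 2 * (2 * ((v i * v j) ^+ 2 + (w i * w j) ^+ 2)));
    last by ring.
  rewrite ler_wpM2l ?sqr_ge0//.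
  by have := sqr_ge0 (v i * v j - w i * w j); lra.
by have := sq v v1; have := sq w w1; lra.
Qed.

(** Cauchy-Schwarz separates [v]. Exchanging sums, symmetry of [b] turns the sum of the
    [g_i^2 a_i(v)^2] into a combination of squared row norms of [g] with weights [v_j^2] of total at
    most 1. *)
Lemma sum_rownorm_le v (g : 'I_d -> R) (M : R) : sqnorm v <= 1 -> 0 <= M ->
  (forall i, Num.sqrt (\sum_j b i j ^+ 2 * g j ^+ 2) <= M) ->
  \sum_i g i * (2 * (v i * rownorm v i)) <= 2 * M.
Proof.
move=> v1 M0 gM.
have -> : \sum_i g i * (2 * (v i * rownorm v i)) =
    2 * \sum_i v i * (g i * rownorm v i).
  by rewrite mulr_sumr; apply: eq_bigr => i _; ring.
rewrite ler_wpM2l// (le_trans (cauchy_schwarz _ _))//.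
rewrite -[leRHS]mul1r ler_pM ?sqrtr_ge0//.
  by rewrite -[leRHS]sqrtr1 ler_wsqrtr.
rewrite -[leRHS]ger0_norm// -sqrtr_sqr ler_wsqrtr//.
have -> : sqnorm (fun i => g i * rownorm v i) =
    \sum_j v j ^+ 2 * \sum_i b j i ^+ 2 * g i ^+ 2.
  rewrite /sqnorm; under eq_bigr do rewrite exprMn sqr_rownorm mulr_sumr.
  rewrite exchange_big; apply: eq_bigr => j _; rewrite mulr_sumr.
  by apply: eq_bigr => i _; rewrite (b_sym i j); ring.
apply: (@le_trans _ _ (\sum_j v j ^+ 2 * M ^+ 2)).
  apply: ler_sum => j _; rewrite ler_wpM2l ?sqr_ge0//.
  have S0 : 0 <= \sum_i b j i ^+ 2 * g i ^+ 2.
    by rewrite sumr_ge0// => i _; rewrite mulr_ge0// sqr_ge0.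
  by rewrite -(sqr_sqrtr S0) lerXn2r// nnegrE ?sqrtr_ge0.
by rewrite -mulr_suml ler_piMl ?sqr_ge0.
Qed.

End increment_comparison.

(** * Symmetric double sums read on the lower triangle *)

Section lower_triangle.
Context {R : realType} {d : nat}.

Lemma sum_lower_triangle (F : 'I_d -> 'I_d -> R) : (forall i j, F i j = F j i) ->
  \sum_(ij : 'I_d * 'I_d | (ij.2 <= ij.1)%N)
    (if ij.1 == ij.2 then 1 else 2) * F ij.1 ij.2 = \sum_i \sum_j F i j.
Proof.
move=> FC.
rewrite (pair_big xpredT xpredT F)/= [RHS](bigID (fun ij : 'I_d * 'I_d => (ij.2 <= ij.1)%N))/=.
rewrite [X in _ = _ + X](_ : _ =
    \sum_(ij : 'I_d * 'I_d | (ij.2 < ij.1)%N) F ij.1 ij.2); last first.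
  rewrite (reindex_inj (h := fun ij : 'I_d * 'I_d => (ij.2, ij.1))); last first.
    by move=> [? ?] [? ?] [-> ->].
  by apply: eq_big => [ij|ij _]; rewrite /= ?ltnNge// FC.
rewrite [X in _ = _ + X]big_mkcond [X in _ = X + _]big_mkcond -big_split.
rewrite big_mkcond; apply: eq_bigr => -[i j] _ /=.
rewrite -(inj_eq val_inj) /= eq_sym.
by case: ltngtP => _; rewrite ?addr0 ?mul1r ?mulr_natl ?mulr2n.
Qed.

(** The squares 1 and 4 of the multiplicities are at most twice the multiplicities 1 and 2. *)
Lemma sum_lower_triangle_le (F : 'I_d -> 'I_d -> R) : (forall i j, F i j = F j i) ->
  (forall i j, 0 <= F i j) ->
  \sum_(ij : 'I_d * 'I_d | (ij.2 <= ij.1)%N)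
    (if ij.1 == ij.2 then 1 else 2) ^+ 2 * F ij.1 ij.2 <= 2 * \sum_i \sum_j F i j.
Proof.
move=> FC F0; rewrite -(sum_lower_triangle FC) mulr_sumr; apply: ler_sum => ij _.
by rewrite mulrA ler_wpM2r//; case: ifP => _; lra.
Qed.

End lower_triangle.

(** * Nets for the spectral norm *)

Section spectral_norm_net.
Context {R : realType} {d : nat} (A : 'M[R]_d).
Hypothesis A_sym : forall i j, A i j = A j i.
Local Notation Af := (fun i j => A i j).
Implicit Types x y : 'I_d -> R.

Lemma norm_coord_le1 x i : sqnorm x <= 1 -> `|x i| <= 1.
Proof.
move=> x1; rewrite -(@expr_le1 _ 2)// real_normK ?num_real//.
by rewrite (le_trans _ x1)// /sqnorm (bigD1 i)//= lerDl sumr_ge0// => j _; exact: sqr_ge0.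
Qed.

(** The Gaussian process only gives access to the quadratic form; symmetry of [A] lets this quantity
    control the spectral norm. *)
Definition numerical_radius : R :=
  sup [set `|bform Af x x| | x in [set x | sqnorm x <= 1]].

Let sqnorm0 : sqnorm (fun _ : 'I_d => 0 : R) <= 1.
Proof. by rewrite /sqnorm big1// => i _; rewrite expr0n. Qed.

Lemma bform_le_numerical_radius x : sqnorm x <= 1 ->
  `|bform Af x x| <= numerical_radius.
Proof.
move=> x1; apply: ub_le_sup; last by exists x.
exists (\sum_i \sum_j `|A i j|) => _ [y y1 <-].
rewrite (le_trans (ler_norm_sum _ _ _))//; apply: ler_sum => i _.
rewrite (le_trans (ler_norm_sum _ _ _))//; apply: ler_sum => j _.
rewrite !normrM -[leRHS]mulr1 ler_pM ?norm_coord_le1// ?mulr_ge0//.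
by rewrite ler_piMl ?norm_coord_le1.
Qed.

Lemma numerical_radius_ge0 : 0 <= numerical_radius.
Proof. exact: le_trans (bform_le_numerical_radius sqnorm0). Qed.

Lemma sqnormZ (c : R) x : sqnorm (fun i => c * x i) = c ^+ 2 * sqnorm x.
Proof. by rewrite /sqnorm mulr_sumr; apply: eq_bigr => i _; rewrite exprMn. Qed.

Lemma sqnorm_eq0 x : sqnorm x = 0 -> x = fun=> 0.
Proof.
move=> x0; apply/funext => i; apply/eqP; rewrite -sqrf_eq0.
have /eqP := x0; rewrite psumr_eq0; last by move=> j _; exact: sqr_ge0.
by move=> /allP/(_ i (mem_index_enum i)).
Qed.

Lemma bform_le_sqnorm x : `|bform Af x x| <= numerical_radius * sqnorm x.
Proof.
have [x0|xn0] := eqVneq (sqnorm x) 0.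
  rewrite x0 mulr0 (sqnorm_eq0 x0) /bform big1 ?normr0// => i _.
  by rewrite big1// => j _; rewrite mulr0.
have x0 : 0 < sqnorm x by rewrite lt_neqAle eq_sym xn0 sqnorm_ge0.
set c := (Num.sqrt (sqnorm x))^-1.
have cc : c ^+ 2 = (sqnorm x)^-1 by rewrite exprVn sqr_sqrtr// ltW.
have := @bform_le_numerical_radius (fun i => c * x i).
rewrite sqnormZ cc mulVf// lexx bformZl bformZr mulrA -expr2 cc => /(_ isT).
have i0 : 0 <= (sqnorm x)^-1 by rewrite invr_ge0 ltW.
by rewrite normrM (ger0_norm i0) [X in X <= _ -> _]mulrC ler_pdivrMr.
Qed.

(** Polarisation, which uses the symmetry of [A], together with the parallelogram identity. *)
Lemma bform_le_polar x y :
  `|bform Af x y| <= numerical_radius * ((sqnorm x + sqnorm y) / 2).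
Proof.
have h1 := bform_le_sqnorm (fun i => x i + y i).
have h2 := bform_le_sqnorm (fun i => x i - y i).
have E : sqnorm (fun i => x i + y i) + sqnorm (fun i => x i - y i) =
    2 * (sqnorm x + sqnorm y).
  rewrite /sqnorm -!big_split mulr_sumr; apply: eq_bigr => i _ /=; ring.
have E' : 4 * bform Af x y = bform Af (fun i => x i + y i) (fun i => x i + y i) -
    bform Af (fun i => x i - y i) (fun i => x i - y i).
  rewrite bformBl !bformBr bformDl !bformDr (bformC y x)//; ring.
have E2 : numerical_radius * sqnorm (fun i => x i + y i) +
    numerical_radius * sqnorm (fun i => x i - y i) =
    4 * (numerical_radius * ((sqnorm x + sqnorm y) / 2)).
  by rewrite -mulrDr E; field.
move: h1 h2; rewrite !ler_norml => /andP[h1 h1'] /andP[h2 h2'].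
by apply/andP; split; lra.
Qed.

(** The polar bound at [x / e] and [y]; homogeneity returns the factor [e]. *)
Lemma bform_le_small (e : R) x y : 0 < e -> sqnorm x <= e ^+ 2 -> sqnorm y <= 1 ->
  `|bform Af x y| <= e * numerical_radius.
Proof.
move=> e0 xe y1.
have -> : x = fun i => e * (e^-1 * x i).
  by apply/funext => i; rewrite mulrA divff ?mul1r// gt_eqF.
rewrite bformZl normrM gtr0_norm// ler_wpM2l ?(ltW e0)//.
rewrite (le_trans (bform_le_polar _ _))// ler_piMr ?numerical_radius_ge0//.
have : sqnorm (fun i => e^-1 * x i) <= 1.
  by rewrite sqnormZ exprVn mulrC ler_pdivrMr ?mul1r// exprn_gt0.
by lra.
Qed.

(** With [y = A x], [|y|^2 = <y, A x>] is at most [|y|] times the numerical radius, by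
    [bform_le_small] at scale [e = |y|]. *)
Lemma spectral_norm_le_numerical_radius : spectral_norm A <= numerical_radius.
Proof.
apply: ge_sup.
  exists (euclidean_norm (A *m 0)); exists (0 : 'cV_d) => //=.
  rewrite /euclidean_norm big1 ?sqrtr0// => i _.
  by rewrite mxE expr0n.
move=> _ [x /= x1 <-].
pose xf i := x i 0; pose yf i := (A *m x) i 0.
have xf1 : sqnorm xf <= 1.
  rewrite leNgt; apply/negP => h; move: x1; apply/negP; rewrite -ltNge.
  by rewrite /euclidean_norm -[ltLHS]sqrtr1 ltr_sqrt// (lt_trans ltr01).
rewrite -/(sqnorm yf) /euclidean_norm -/(sqnorm yf).
have yy : bform Af yf xf = sqnorm yf.
  rewrite bformE; apply: eq_bigr => i _; rewrite expr2; congr (_ * _).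
  by rewrite /yf mxE.
have [y0|yn0] := eqVneq (sqnorm yf) 0.
  by rewrite y0 sqrtr0 numerical_radius_ge0.
have y0 : 0 < sqnorm yf by rewrite lt_neqAle eq_sym yn0 sqnorm_ge0.
have s0 : 0 < Num.sqrt (sqnorm yf) by rewrite sqrtr_gt0.
have := @bform_le_small (Num.sqrt (sqnorm yf)) yf xf s0.
rewrite sqr_sqrtr ?(ltW y0)// lexx yy => /(_ isT xf1).
rewrite ger0_norm ?(ltW y0)// -{1}(sqr_sqrtr (ltW y0)) expr2.
by rewrite ler_pM2l.
Qed.

(** Passing from [x] to a net point [y] changes the form by [<x - y, A x> + <y, A (x - y)>], at most
    [2 e] times the numerical radius, which is absorbed on the left. *)
Lemma spectral_norm_net (e K : R) : 0 < e -> 2 * e <= 1 ->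
  (forall x, sqnorm x <= 1 -> exists y, [/\ sqnorm y <= 1,
     sqnorm (fun i => x i - y i) <= e ^+ 2 & `|bform Af y y| <= K]) ->
  (1 - 2 * e) * spectral_norm A <= K.
Proof.
move=> e0 e1 net.
have : numerical_radius <= K + 2 * e * numerical_radius.
  apply: ge_sup; first by exists `|bform Af (fun=> 0) (fun=> 0)|; exists (fun=> 0).
  move=> _ [x /= x1 <-]; have [y [y1 xy yK]] := net x x1.
  have h1 := bform_le_small e0 xy x1.
  have h2 := bform_le_small e0 xy y1.
  rewrite (bformC _ y) in h2 => //.
  have -> : bform Af x x = bform Af y y + bform Af (fun i => x i - y i) x +
      bform Af y (fun i => x i - y i) by rewrite bformBl bformBr; ring.
  rewrite (le_trans (ler_normD _ _))//.
  have := ler_normD (bform Af y y) (bform Af (fun i => x i - y i) x).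
  by lra.
have := ler_wpM2l (_ : 0 <= 1 - 2 * e) spectral_norm_le_numerical_radius.
rewrite subr_ge0 => /(_ e1); lra.
Qed.

End spectral_norm_net.

(** * A finite grid as a net of the ball *)

Section grid.
Context {R : realType} {d : nat} (m : nat).
Hypothesis m_gt0 : (0 < m)%N.

(** Coordinates run over the multiples of [1 / m] in [[-1, 1]], hence [2 m + 1] indices. *)
Definition grid_point (k : {ffun 'I_d -> 'I_(m + m).+1}) (i : 'I_d) : R :=
  (k i)%:R / m%:R - 1.

(** Points outside the ball are sent to 0 rather than removed, so that the whole function type
    indexes the net. *)
Definition net_point k : 'I_d -> R :=
  if sqnorm (grid_point k) <= 1 then grid_point k else fun=> 0.

Lemma sqnorm_net_point k : sqnorm (net_point k) <= 1.
Proof.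
rewrite /net_point; case: ifP => // _.
by rewrite /sqnorm big1// => i _; rewrite expr0n.
Qed.

Let m0 : 0 < m%:R :> R. Proof. by rewrite ltr0n. Qed.

(** Rounding is towards 0: absolute values do not increase, so a rounded vector stays in the
    ball. *)
Lemma grid_approx1 (t : R) : `|t| <= 1 -> exists k : 'I_(m + m).+1,
  `|k%:R / m%:R - 1| <= `|t| /\ `|t - (k%:R / m%:R - 1)| <= m%:R^-1.
Proof.
move=> t1; set n := Num.trunc (`|t| * m%:R).
have tm0 : 0 <= `|t| * m%:R by rewrite mulr_ge0// ltW.
have /andP[n1 n2] := truncn_itv tm0.
have nm : (n <= m)%N.
  by rewrite -(ler_nat R) (le_trans n1)// ler_piMl// ltW.
set r : R := n%:R / m%:R.
have h1 : r <= `|t| by rewrite /r ler_pdivrMr.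
have h2 : `|t| <= r + m%:R^-1.
  by rewrite -[m%:R^-1]mul1r /r -mulrDl natr1 ler_pdivlMr// ltW.
have r0 : 0 <= r by rewrite divr_ge0.
have [t0|t0] := leP 0 t.
  have km : (m + n < (m + m).+1)%N by rewrite ltnS leq_add2l.
  exists (Ordinal km); rewrite /= natrD.
  have -> : (m%:R + n%:R) / m%:R - 1 = r by rewrite /r; field; rewrite gt_eqF.
  move: h1 h2; rewrite (ger0_norm t0) (ger0_norm r0) => h1 h2; split => //.
  by rewrite ger0_norm ?subr_ge0// lerBlDl.
have km : (m - n < (m + m).+1)%N by rewrite ltnS (leq_trans (leq_subr _ _))// leq_addr.
exists (Ordinal km); rewrite /= natrB//.
have -> : (m%:R - n%:R) / m%:R - 1 = - r by rewrite /r; field; rewrite gt_eqF.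
move: h1 h2; rewrite (ltr0_norm t0) normrN (ger0_norm r0) opprK => h1 h2.
by split => //; rewrite ler0_norm; lra.
Qed.

Lemma net_point_approx (e : R) (x : 'I_d -> R) : d%:R <= e ^+ 2 * m%:R ^+ 2 ->
  sqnorm x <= 1 -> exists k, sqnorm (fun i => x i - net_point k i) <= e ^+ 2.
Proof.
move=> dem x1.
have /choice[k kP] : forall i, exists k : 'I_(m + m).+1,
    `|k%:R / m%:R - 1| <= `|x i| /\ `|x i - (k%:R / m%:R - 1)| <= m%:R^-1.
  by move=> i; apply: grid_approx1; exact: norm_coord_le1.
exists (finfun k).
have gE i : grid_point (finfun k) i = (k i)%:R / m%:R - 1.
  by rewrite /grid_point ffunE.
have -> : net_point (finfun k) = grid_point (finfun k).
  rewrite /net_point ifT// (le_trans _ x1)//; apply: ler_sum => i _.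
  rewrite gE -(real_normK (num_real (_ - _))) -[leRHS](real_normK (num_real (x i))).
  by rewrite lerXn2r ?nnegrE//; have [] := kP i.
apply: (@le_trans _ _ (\sum_(i < d) m%:R^-1 ^+ 2)).
  apply: ler_sum => i _; rewrite gE -(real_normK (num_real (_ - _))).
  rewrite lerXn2r ?nnegrE// ?invr_ge0 ?(ltW m0)//; by have [] := kP i.
rewrite sumr_const card_ord -[_ *+ d]mulr_natl exprVn ler_pdivrMr//.
by rewrite exprn_gt0.
Qed.

End grid.

(** * The bound for Gaussian matrices *)

(** The integral of a nonnegative function is a supremum over the simple functions below it, so it
    is monotone whether or not the functions are measurable. This is what handles the spectral
    norm. *)
Lemma ge0_le_integralW d (T : measurableType d) (R : realType)
    (mu : {measure set T -> \bar R}) (f g : T -> \bar R) :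
  (forall x, 0 <= f x)%E -> (forall x, f x <= g x)%E ->
  (\int[mu]_x f x <= \int[mu]_x g x)%E.
Proof.
move=> f0 fg; rewrite !ge0_integralTE//; last first.
  by move=> x; exact: le_trans (fg x).
by apply: le_ereal_sup => _ [h hf <-]; exists h => // x; exact: le_trans (fg x).
Qed.

Lemma le_integral_ge0 d (T : measurableType d) (R : realType)
    (mu : {measure set T -> \bar R}) (f g : T -> \bar R) :
  (forall x, 0 <= g x)%E -> (forall x, f x <= g x)%E ->
  (\int[mu]_x f x <= \int[mu]_x g x)%E.
Proof.
move=> g0 fg; rewrite integralE.
apply: (@le_trans _ _ (\int[mu]_x f^\+ x)%E).
  by rewrite geeDl// oppe_le0 integral_ge0// => x _; rewrite funeneg_ge0.
apply: ge0_le_integralW => x; first by rewrite funepos_ge0.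
by rewrite funeposE ge_max fg g0.
Qed.

Section log_sum_exp_bounds.
Context {R : realType} {V : finType} (v0 : V).

Lemma le_lse (z : V -> R) v : z v <= lse z.
Proof.
rewrite -[z v]expRK /lse ler_ln ?posrE ?expR_gt0 ?(sum_expR_gt0 v0)//.
by rewrite (bigD1 v)//= lerDl sumr_ge0// => w _; rewrite expR_ge0.
Qed.

Lemma lse_le (z : V -> R) (c : R) : (forall v, z v <= c) ->
  lse z <= ln #|V|%:R + c.
Proof.
move=> zc; have V0 : 0 < #|V|%:R :> R by rewrite ltr0n; apply/card_gt0P; exists v0.
rewrite -[c in leRHS]expRK -lnM ?posrE ?expR_gt0//.
rewrite /lse ler_ln ?posrE ?(sum_expR_gt0 v0) ?mulr_gt0 ?expR_gt0//.
rewrite mulr_natl -sumr_const; apply: ler_sum => v _.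
by rewrite ler_expR.
Qed.

(** The extra Gaussian is integrated out here: along the line [lse] is at most [ln |V| + c + k |s|],
    and [|s|] is replaced by the weight of mean [sqrt 2]. *)
Lemma smooth_lse_le (z a : V -> R) (c k : R) : 0 <= k -> (forall v, z v <= c) ->
  (forall v, `|a v| <= k) -> smooth a lse z <= ln #|V|%:R + c + k * Num.sqrt 2.
Proof.
move=> k0 zc ak; have lL := sup_lipschitz_lse (R := R) v0.
set C := ln _ + c.
have mg : measurable_fun [set: measurableTypeR R] (fun s => k * gweight s).
  by apply: measurable_funM => //; exact: measurable_gweight.
have bg (s : R) : `|k * gweight s| <= k * gweight s.
  by rewrite ger0_norm// mulr_ge0// gweight_ge0.
have bC (s : R) : `|C| <= `|C| * gweight s by rewrite ler_peMr// gweight_ge1.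
have <- : gexp (fun s => C + k * gweight s) = C + k * Num.sqrt 2.
  rewrite (@gexpD _ `|C| k (fun=> C))// gexp_cst (@gexpZ _ 1) ?gexp_gweight//.
    exact: measurable_gweight.
  by move=> s; rewrite mul1r ger0_norm// gweight_ge0.
apply: (@le_gexp _ _ (`|C| + k) _ _ (measurable_smooth_line lL z a) _
  (smooth_bound lL z a)).
- exact: measurable_funD.
- by move=> s; rewrite (le_trans (ler_normD _ _))// mulrDl lerD.
- move=> s; rewrite /C -addrA; apply: lse_le => v; rewrite lerD//.
  rewrite (le_trans (ler_norm _))// normrM mulrC.
  by rewrite ler_pM// norm_le_gweight.
Qed.

End log_sum_exp_bounds.

Lemma spectral_norm_ge0 (R : realType) (n : nat) (A : 'M[R]_n) : 0 <= spectral_norm A.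
Proof.
(* Outside [has_sup], [sup] takes the default value 0. *)
rewrite /spectral_norm; have [h|/sup_out ->//] := pselect (has_sup
  [set euclidean_norm (A *m x) | x in [set x | euclidean_norm x <= 1]]).
have [[y [x x1 xy]] _] := h.
by apply: (le_trans (sqrtr_ge0 _)); apply: (sup_upper_bound h); exists x.
Qed.

Section gaussian_matrix_bound.
Context (disp : measure_display) (T : measurableType disp)
    (R : realType) (P : probability T R) (d : nat)
    (b : 'I_d -> 'I_d -> R)
    (b_ge0 : forall i j, 0 <= b i j)
    (b_sym : forall i j, b i j = b j i)
    (gX : 'I_d * 'I_d -> {RV P >-> R})
    (gX_gauss : forall i j : 'I_d, (j <= i)%N -> std_gaussian (gX (i, j)))
    (gX_indep : mutually_independent
       [set ij : 'I_d * 'I_d | (ij.2 <= ij.1)%N] gX)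
    (g : 'I_d -> {RV P >-> R})
    (g_gauss : forall i, std_gaussian (g i))
    (g_indep : mutually_independent [set: 'I_d] g)
    (B_psd : positive_semidefinite (\matrix_(i, j) (b i j ^+ 2))).
Local Notation beta := (\big[Num.max/0]_(i < d) \big[Num.max/0]_(j < d) b i j).
Local Notation maxrow := (fun w => \big[Num.max/0]_(i < d)
                   Num.sqrt (\sum_(j < d) b i j ^+ 2 * g j w ^+ 2)).

Lemma le_beta i j : b i j <= beta.
Proof.
apply: le_trans (le_bigmax _ (fun i => \big[Num.max/0]_(j < d) b i j) i).
exact: (le_bigmax _ (fun j => b i j)).
Qed.

Lemma beta_ge0 : 0 <= beta.
Proof.
exact: bigmax_ge_id.
Qed.

Lemma maxrow_ge0 w : 0 <= maxrow w.
Proof.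
exact: bigmax_ge_id.
Qed.

Lemma measurable_maxrow : measurable_fun setT maxrow.
Proof.
have key (r : seq 'I_d) : measurable_fun setT (fun w => \big[Num.max/0]_(i <- r)
    Num.sqrt (\sum_(j < d) b i j ^+ 2 * g j w ^+ 2)).
  elim: r => [|i r IH].
    by rewrite (_ : (fun _ => _) = cst 0)//; apply/funext => w; rewrite big_nil.
  rewrite (_ : (fun _ => _) = (fun w =>
      Num.sqrt (\sum_(j < d) b i j ^+ 2 * g j w ^+ 2)) \max (fun w =>
      \big[Num.max/0]_(i <- r) Num.sqrt (\sum_(j < d) b i j ^+ 2 * g j w ^+ 2))).
    apply: measurable_maxr => //.
  2: by apply/funext => w; rewrite big_cons.
  apply: (measurableT_comp (f := @Num.sqrt R)).
    by apply: continuous_measurable_fun; exact: sqrt_continuous.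
  apply: measurable_sum => j; apply: measurable_funM => //.
  exact: measurable_funX.
exact: key.
Qed.

Lemma B_bform_ge0 (x : 'I_d -> R) : 0 <= bform (fun i j => b i j ^+ 2) x x.
Proof.
have [_ /(_ (\col_i x i))] := B_psd; congr (0 <= _).
rewrite mxE /bform exchange_big; apply: eq_bigr => j _.
rewrite !mxE mulr_suml; apply: eq_bigr => i _.
by rewrite !mxE.
Qed.

Lemma gaussian_mx_sym w i j : gaussian_mx b gX w i j = gaussian_mx b gX w j i.
Proof.
rewrite !mxE (b_sym i j); congr (_ * _).
case: (ltngtP i j) => // /val_inj ->; by [].
Qed.

Section net.
Variable m : nat.
Local Notation V := ({ffun 'I_d -> 'I_(m + m).+1} * bool)%type.

Definition net_sign (v : V) : R := (-1) ^+ v.2.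

(** The 2 off the diagonal counts the two entries governed by one variable of the lower triangle. *)
Definition matrix_coef (ij : 'I_d * 'I_d) (v : V) : R :=
  net_sign v * ((if ij.1 == ij.2 then 1 else 2) *
    (b ij.1 ij.2 * (net_point v.1 ij.1 * net_point v.1 ij.2))).

Definition row_coef (i : 'I_d) (v : V) : R :=
  2 * (net_point v.1 i * rownorm b (net_point v.1) i).

Definition sign_coef (v : V) : R := net_sign v * (Num.sqrt 2 * beta).

Definition lower_pairs : seq ('I_d * 'I_d) :=
  [seq ij : 'I_d * 'I_d <- enum {: 'I_d * 'I_d} | (ij.2 <= ij.1)%N].

(** For equal signs the row terms dominate alone, by positivity of [B]; for opposite signs the sign
    term dominates alone, since [(2 sqrt 2 beta)^2 = 8 beta^2]. *)
Lemma matrix_row_increments (v w : V) :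
  \sum_(ij <- lower_pairs) (matrix_coef ij v - matrix_coef ij w) ^+ 2 <=
  \sum_i (row_coef i v - row_coef i w) ^+ 2 + (sign_coef v - sign_coef w) ^+ 2.
Proof.
set x := @net_point R d m v.1; set y := @net_point R d m w.1.
have x1 : sqnorm x <= 1 by exact: sqnorm_net_point.
have y1 : sqnorm y <= 1 by exact: sqnorm_net_point.
pose F i j := b i j ^+ 2 *
  (net_sign v * (x i * x j) - net_sign w * (y i * y j)) ^+ 2.
have FC i j : F i j = F j i.
  by rewrite /F b_sym (mulrC (x i)) (mulrC (y i)).
have F0 i j : 0 <= F i j by rewrite mulr_ge0// sqr_ge0.
rewrite /lower_pairs big_filter big_enum_cond/=.
have -> : \sum_(ij : 'I_d * 'I_d | (ij.2 <= ij.1)%N)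
    (matrix_coef ij v - matrix_coef ij w) ^+ 2 =
    \sum_(ij : 'I_d * 'I_d | (ij.2 <= ij.1)%N)
      (if ij.1 == ij.2 then 1 else 2) ^+ 2 * F ij.1 ij.2.
  by apply: eq_bigr => ij _; rewrite /matrix_coef /F -/x -/y; ring.
apply: (le_trans (sum_lower_triangle_le FC F0)).
case: (eqVneq v.2 w.2) => vw.
  apply: (@le_trans _ _ (\sum_i (row_coef i v - row_coef i w) ^+ 2)); last first.
    by rewrite lerDl sqr_ge0.
  apply: le_trans (increment_comparison b_sym B_bform_ge0 x y).
  rewrite le_eqVlt; apply/orP; left; apply/eqP; congr (2 * _).
  apply: eq_bigr => i _; apply: eq_bigr => j _; rewrite /F /net_sign vw.
  by rewrite -mulrBr exprMn sqrr_sign mul1r.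
apply: (@le_trans _ _ ((sign_coef v - sign_coef w) ^+ 2)); last first.
  by rewrite lerDr sumr_ge0// => i _; rewrite sqr_ge0.
have wv : net_sign w = - net_sign v.
  rewrite /net_sign; move: vw; case: v.2; case: w.2 => //= _.
    by rewrite expr0 expr1 opprK.
have -> : (sign_coef v - sign_coef w) ^+ 2 = 8 * beta ^+ 2.
  rewrite /sign_coef wv.
  rewrite (_ : _ ^+ 2 = 4 * net_sign v ^+ 2 * (Num.sqrt 2 ^+ 2) * beta ^+ 2);
    last by ring.
  by rewrite sqr_sqrtr// sqrr_sign; ring.
apply: le_trans (increment_comparison_flip b_ge0 x1 y1 le_beta).
rewrite le_eqVlt; apply/orP; left; apply/eqP; congr (2 * _).
apply: eq_bigr => i _; apply: eq_bigr => j _; rewrite /F wv.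
by rewrite mulNr opprK -mulrDr exprMn sqrr_sign mul1r.
Qed.

Definition matrix_process (w : T) (v : V) : R :=
  \sum_(ij <- lower_pairs) gX ij w * matrix_coef ij v.

Lemma matrix_processE w v : matrix_process w v =
  net_sign v * bform (fun i j => gaussian_mx b gX w i j)
    (net_point v.1) (net_point v.1).
Proof.
rewrite /matrix_process /lower_pairs big_filter big_enum_cond/=.
set x := @net_point R d m v.1.
rewrite /bform -(sum_lower_triangle
  (F := fun i j => x i * gaussian_mx b gX w i j * x j)); last first.
  by move=> i j; rewrite gaussian_mx_sym; ring.
rewrite mulr_sumr; apply: eq_bigr => -[i j] /= ji.
by rewrite /matrix_coef /= -/x mxE ji; ring.
Qed.

Hypothesis m_gt0 : (0 < m)%N.
Let v0 : V := ([ffun=> ord0], true).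

Lemma spectral_norm_le_lse (e t : R) w : 0 < e -> 2 * e <= 1 -> 0 < t ->
  d%:R <= e ^+ 2 * m%:R ^+ 2 ->
  (1 - 2 * e) * spectral_norm (gaussian_mx b gX w) <=
  t^-1 * lse (fun v => \sum_(ij <- lower_pairs) gX ij w * (t * matrix_coef ij v)).
Proof.
move=> e0 e1 t0 dem; apply: spectral_norm_net => //.
  exact: gaussian_mx_sym.
move=> x x1; have [k kx] := net_point_approx m_gt0 dem x1.
exists (net_point k); split => //; first exact: sqnorm_net_point.
rewrite mulrC ler_pdivlMr//.
set z := (fun v : V => _).
have zE s : z (k, s) = t * ((-1) ^+ s *
    bform (fun i j => gaussian_mx b gX w i j) (net_point k) (net_point k)).
  rewrite -(matrix_processE w (k, s)) /z /matrix_process mulr_sumr.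
  by apply: eq_bigr => ij _; ring.
(* The two signs at one grid point bound the form from both sides. *)
have h1 := le_lse v0 z (k, false); have h2 := le_lse v0 z (k, true).
rewrite zE expr0 mul1r in h1; rewrite zE expr1 mulN1r in h2.
rewrite mulrC -ler_pdivlMl// ler_norml; apply/andP; split.
  by rewrite lerNl ler_pdivlMl// mulrN -mulrN.
by rewrite ler_pdivlMl.
Qed.

(** [t] is an inverse temperature: [lse] of the process scaled by [t], divided by [t], is the
    maximum up to [ln |V| / t]. *)
Lemma expectation_spectral_norm_net (e t : R) : 0 < e -> 2 * e < 1 -> 0 < t ->
  d%:R <= e ^+ 2 * m%:R ^+ 2 ->
  ((1 - 2 * e)%:E * 'E_P[fun w => spectral_norm (gaussian_mx b gX w)] <=
   2%:E * 'E_P[maxrow] + (2 * beta)%:E + (t^-1 * ln #|{: V}|%:R)%:E)%E.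
Proof.
move=> e0 e1 t0 dem; have lL := sup_lipschitz_lse (R := R) v0.
have e1' : 0 < 1 - 2 * e by rewrite subr_gt0.
have t0' : 0 <= t^-1 by rewrite invr_ge0 ltW.
have V1 : 0 <= ln #|{: V}|%:R :> R.
  by rewrite ln_ge0// ler1n; apply/card_gt0P; exists v0.
have sn0 w : 0 <= spectral_norm (gaussian_mx b gX w) by exact: spectral_norm_ge0.
rewrite unlock.
pose XX := fun ij => t \*o matrix_coef ij.
pose YY := fun i => t \*o row_coef i.
pose EE := t \*o sign_coef.
have step1 : ((1 - 2 * e)%:E * \int[P]_w (spectral_norm (gaussian_mx b gX w))%:E <=
    t^-1%:E * (smooths (map XX lower_pairs) lse (fun=> 0))%:E)%E.
  have gXD (ij : 'I_d * 'I_d) : [set ij : 'I_d * 'I_d | (ij.2 <= ij.1)%N] ij ->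
      std_gaussian (gX ij) by case: ij => i j /= ji; exact: gX_gauss.
  have lpD ij : ij \in lower_pairs -> [set ij : 'I_d * 'I_d | (ij.2 <= ij.1)%N] ij.
    by rewrite mem_filter => /andP[].
  rewrite -(integral_gaussian_sum gX_indep gXD XX lL (fun=> 0) _ lpD); last first.
    by rewrite filter_uniq// enum_uniq.
  set F := (fun x : T => (lse _)%:E).
  have iF : P.-integrable setT F.
    exact: (integrable_gaussian_sum gXD XX lL (fun=> 0) lpD).
  (* The factor [1 - 2 e] is divided out on the integrable side, so that the integral of the norm is
     used only through monotonicity. *)
  have -> : (t^-1%:E * \int[P]_x F x =
      (1 - 2 * e)%:E * \int[P]_x (((1 - 2 * e)^-1 * t^-1)%:E * F x))%E.
    by rewrite integralZl// muleA -EFinM mulrA divff ?mul1r// gt_eqF.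
  rewrite lee_wpmul2l ?lee_fin ?(ltW e1')//.
  apply: ge0_le_integralW => w; first by rewrite lee_fin.
  rewrite -EFinM lee_fin -mulrA mulrC ler_pdivlMr// mulrC.
  have := spectral_norm_le_lse w e0 (ltW e1) t0 dem.
  congr (_ <= _ * lse _); apply/funext => v; rewrite add0r.
  by [].
have step2 : smooths (map XX lower_pairs) lse (fun=> 0) <=
    smooths (map YY (enum 'I_d)) (smooth EE lse) (fun=> 0).
  (* The extra Gaussian is the innermost smoothing; it will be bounded at fixed values of the
     [g i]. *)
  rewrite -[smooth EE lse]/(smooths [:: EE] lse) -smooths_cat.
  apply: (sudakov_fernique_lse v0) => v w.
  rewrite big_cat big_seq1 big_map [X in _ <= X + _]big_map
    [X in _ <= X + _]big_enum /=.
  have := ler_wpM2l (sqr_ge0 t) (matrix_row_increments v w).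
  rewrite mulrDr !mulr_sumr => H.
  rewrite (le_trans _ (le_trans H _))// le_eqVlt; apply/orP; left; apply/eqP.
    by apply: eq_bigr => ij _; rewrite /XX/=; ring.
  congr (_ + _); last by rewrite /EE/=; ring.
  by apply: eq_bigr => i _; rewrite /YY/=; ring.
have step3 : ((smooths (map YY (enum 'I_d)) (smooth EE lse) (fun=> 0))%:E <=
    \int[P]_w ((t * (2 * maxrow w))%:E + (ln #|{: V}|%:R + t * (2 * beta))%:E))%E.
  have EL := sup_lipschitz_smooth lL EE.
  have gD i : [set: 'I_d] i -> std_gaussian (g i) by move=> _; exact: g_gauss.
  have eD i : i \in enum 'I_d -> [set: 'I_d] i by [].
  rewrite -(integral_gaussian_sum g_indep gD YY EL (fun=> 0) _ eD); last first.
    exact: enum_uniq.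
  apply: le_integral_ge0 => w.
    rewrite -EFinD lee_fin addr_ge0// ?mulr_ge0 ?(ltW t0) ?maxrow_ge0//.
    by rewrite addr_ge0// !mulr_ge0 ?(ltW t0) ?beta_ge0.
  rewrite -EFinD lee_fin.
  apply: (le_trans (smooth_lse_le v0 (c := t * (2 * maxrow w))
    (k := t * (Num.sqrt 2 * beta)) _ _ _)).
  - by rewrite !mulr_ge0 ?(ltW t0) ?sqrtr_ge0 ?beta_ge0.
  - move=> v; rewrite add0r big_enum/=.
    have -> : \sum_(i < d) g i w * YY i v = t * \sum_i g i w * row_coef i v.
      by rewrite mulr_sumr; apply: eq_bigr => i _; rewrite /YY/=; ring.
    rewrite ler_pM2l//; apply: sum_rownorm_le => //.
    + exact: sqnorm_net_point.
    + exact: maxrow_ge0.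
    + by move=> i; exact: (le_bigmax _ (fun i => Num.sqrt (\sum_j b i j ^+ 2 * g j w ^+ 2))).
  - move=> v; rewrite /EE/= /sign_coef /net_sign normrM gtr0_norm//.
    rewrite normrM normr_sign mul1r ger0_norm// mulr_ge0 ?sqrtr_ge0 ?beta_ge0//.
  - rewrite le_eqVlt; apply/orP; left; apply/eqP.
    have := @sqr_sqrtr R 2 (ler0n _ _); rewrite expr2 => s2.
    rewrite (_ : t * (Num.sqrt 2 * beta) * Num.sqrt 2 =
      t * (Num.sqrt 2 * Num.sqrt 2 * beta)); last by ring.
    by rewrite s2; ring.
rewrite (le_trans step1)//.
rewrite (@le_trans _ _ (t^-1%:E * \int[P]_w ((t * (2 * maxrow w))%:E +
   (ln #|{: V}|%:R + t * (2 * beta))%:E))%E)//.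
  rewrite lee_wpmul2l ?lee_fin//.
  by apply: le_trans step3; rewrite lee_fin.
rewrite le_eqVlt; apply/orP; left; apply/eqP.
have mM : measurable_fun setT (fun w => (maxrow w)%:E).
  by apply/measurable_EFinP; exact: measurable_maxrow.
have M0 w : (0 <= (maxrow w)%:E)%E by rewrite lee_fin maxrow_ge0.
have tM0 w : (0 <= (t * (2 * maxrow w))%:E)%E.
  by rewrite lee_fin !mulr_ge0 ?(ltW t0) ?maxrow_ge0.
have mtM : measurable_fun setT (fun w => (t * (2 * maxrow w))%:E).
  apply/measurable_EFinP; apply: measurable_funM => //.
  by apply: measurable_funM => //; exact: measurable_maxrow.
have C0 : (0 <= (ln #|{: V}|%:R + t * (2 * beta))%:E)%E.
  by rewrite lee_fin addr_ge0// !mulr_ge0 ?(ltW t0) ?beta_ge0.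
rewrite ge0_integralD//.
rewrite integral_cst//= probability_setT mule1.
under eq_integral do rewrite mulrA EFinM.
rewrite ge0_integralZl//; last by rewrite lee_fin mulr_ge0// ltW.
rewrite muleDr//; last exact: fin_num_adde_defl.
rewrite muleA -EFinM mulrA mulVf ?gt_eqF// mul1r -addeA; congr (_ + _)%E.
rewrite -!EFinD -EFinM; congr (_%:E).
by field; rewrite gt_eqF.
Qed.

End net.

Lemma expectation_spectral_norm_le :
  ('E_P[fun w => spectral_norm (gaussian_mx b gX w)] <=
   2%:E * 'E_P[maxrow] + (2 * beta)%:E)%E.
Proof.
have sn0 w : 0 <= spectral_norm (gaussian_mx b gX w) by exact: spectral_norm_ge0.
apply/lee_mul01Pr.
  by rewrite unlock integral_ge0// => w _; rewrite lee_fin.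
(* The loss [1 - 2 e] of the net is matched with an arbitrary factor [r < 1]. *)
move=> r /andP[r0 r1]; pose e := (1 - r) / 2.
have e0 : 0 < e by rewrite divr_gt0// subr_gt0.
have e1 : 2 * e < 1 by rewrite /e; lra.
have rE : r = 1 - 2 * e by rewrite /e; field.
have e20 : 0 < e ^+ 2 by rewrite exprn_gt0.
(* [m >= 1] and [m >= d / e^2] give [e^2 m^2 >= e^2 m >= d]. *)
pose m := (Num.bound (d%:R / e ^+ 2)).+1.
have dem : d%:R <= e ^+ 2 * m%:R ^+ 2.
  rewrite mulrC -ler_pdivrMr//.
  have h : 0 <= d%:R / e ^+ 2 by rewrite divr_ge0// ltW.
  have m1 : 1 <= m%:R :> R by rewrite ler1n.
  apply: (@le_trans _ _ (m%:R : R)); last by rewrite expr2 ler_peMr// (le_trans ler01).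
  by rewrite ltW// (lt_trans (archi_boundP h))// ltr_nat.
apply/lee_addgt0Pr => k k0; rewrite rE.
set c : R := ln #|{: {ffun 'I_d -> 'I_(m + m).+1} * bool}|%:R.
have c0 : 0 <= c.
  by rewrite ln_ge0// ler1n; apply/card_gt0P; exists ([ffun=> ord0], true).
(* With this [t] the entropy term is [k * c / (c + 1) <= k]; the added 1 makes [t] positive from
   [c >= 0]. *)
have t0 : 0 < (c + 1) / k by rewrite divr_gt0// ltr_wpDl.
apply: (le_trans (expectation_spectral_norm_net (m := m) _ e0 e1 t0 dem)) => //.
rewrite leeD2l// lee_fin -/c invf_div mulrAC ler_pdivrMr ?ltr_wpDl//.
by rewrite ler_pM2l// lerDl.
Qed.

End gaussian_matrix_bound.

Theorem corollary4p5 (disp : measure_display) (T : measurableType disp)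
    (R : realType) (P : probability T R) (d : nat) (hd : (1 <= d)%N)
    (b : 'I_d -> 'I_d -> R)
    (b_ge0 : forall i j, 0 <= b i j)
    (b_sym : forall i j, b i j = b j i)
    (gX : 'I_d * 'I_d -> {RV P >-> R})
    (gX_gauss : forall i j : 'I_d, (j <= i)%N -> std_gaussian (gX (i, j)))
    (gX_indep : mutually_independent
       [set ij : 'I_d * 'I_d | (ij.2 <= ij.1)%N] gX)
    (g : 'I_d -> {RV P >-> R})
    (g_gauss : forall i, std_gaussian (g i))
    (g_indep : mutually_independent [set: 'I_d] g)
    (B_psd : positive_semidefinite (\matrix_(i, j) (b i j ^+ 2))) :
  ('E_P[fun w => spectral_norm (gaussian_mx b gX w)] <=
     2%:E * 'E_P[fun w => (\big[Num.max/0]_(i < d)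
                   Num.sqrt (\sum_(j < d) b i j ^+ 2 * g j w ^+ 2))%R] +
     (2 * \big[Num.max/0]_(i < d) \big[Num.max/0]_(j < d) b i j)%R%:E)%E.
Proof.
exact: (expectation_spectral_norm_le b_ge0 b_sym gX_gauss gX_indep g_gauss g_indep
  B_psd).
Qed.
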